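(* There is an absolute constant $C>0$ such that the following holds. Let $\mathbf x_1,\dots,\mathbf x_n\in\mathbb R^d$, let $\ell_1,\dots,\ell_n:\mathbb R\to\mathbb R$ be convex, twice differentiable and smooth, let $\lambda>0$, $0<k\le n$, and let $m$ be a positive integer. Let $$\mathcal L(\mathbf w)=\frac1n\sum_{i=1}^n\ell_i(\mathbf w^\top\mathbf x_i)+\frac\lambda2\|\mathbf w\|^2,$$ and let $\widehat{\mathcal L}_1,\dots,\widehat{\mathcal L}_m$ be i.i.d. copies of the random function $$\widehat{\mathcal L}(\mathbf w)=\frac1k\sum_{i=1}^n b_i\,\ell_i(\mathbf w^\top\mathbf x_i)+\frac\lambda2\|\mathbf w\|^2,\qquad b_1,\dots,b_n\ \text{independent } \mathrm{Bernoulli}(k/n).$$ Fix $\mathbf w\in\mathbb R^d$ and define $a_t=\det\big(\nabla^2\widehat{\mathcal L}_t(\mathbf w)\big)$, $\widehat{\mathbf p}_t=\nabla^{-2}\widehat{\mathcal L}_t(\mathbf w)\,\nabla\mathcal L(\mathbf w)$, $\mathbf p=\nabla^{-2}\mathcal L(\mathbf w)\,\nabla\mathcal L(\mathbf w)$ and $$\mu=\frac1d\max_i\ \ell_i''(\mathbf w^\top\mathbf x_i)\,\|\mathbf x_i\|^2_{\nabla^{-2}\mathcal L(\mathbf w)} .$$ For any $\delta,\eta\in(0,1)$, if $k\ge C\eta^{-2}\mu d^2\log^3\frac d\delta$, then with probability at least $1-\delta$, $$\bigg\|\frac{\sum_{t=1}^m a_t\,\widehat{\mathbf p}_t}{\sum_{t=1}^m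 a_t}-\mathbf p\bigg\|_{\nabla^2\mathcal L(\mathbf w)}\ \le\ \frac{\eta}{\sqrt m}\,\|\mathbf p\|_{\nabla^2\mathcal L(\mathbf w)} .$$
   Context: $\nabla f$ and $\nabla^2 f$ denote the gradient and Hessian of $f$, and $\nabla^{-2}f(\mathbf w)=(\nabla^2 f(\mathbf w))^{-1}$. For a positive definite matrix $\mathbf M$, $\|\mathbf v\|_{\mathbf M}=\sqrt{\mathbf v^\top\mathbf M\mathbf v}$. Explicitly, $\nabla^2\mathcal L(\mathbf w)=\frac1n\sum_i\ell_i''(\mathbf w^\top\mathbf x_i)\mathbf x_i\mathbf x_i^\top+\lambda\mathbf I$ and $\nabla^2\widehat{\mathcal L}(\mathbf w)=\frac1k\sum_i b_i\ell_i''(\mathbf w^\top\mathbf x_i)\mathbf x_i\mathbf x_i^\top+\lambda\mathbf I$. ''Smooth'' refers to the usual optimization notion (Lipschitz derivative).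
   Formalization: For d = 1 the claim is restricted to δ ≤ 1/2 (for d ≥ 2 all δ in (0,1) are covered), because for d = 1 and δ near 1 log(d/δ) tends to 0 and the claim is false for every constant C. *)

(* Defs.v *)
From HB Require Import structures.
From mathcomp Require Export all_boot all_order all_algebra.
From mathcomp Require Export all_classical all_reals all_analysis.

Set Implicit Arguments.
Unset Strict Implicit.
Unset Printing Implicit Defensive.

Import Order.TTheory GRing.Theory Num.Theory.
Import numFieldNormedType.Exports.

Local Open Scope classical_set_scope.
Local Open Scope ring_scope.

Definition dotv (R : realType) (d : nat) (u v : 'cV[R]_d) : R :=
  (u^T *m v) 0 0.

(* The library norm `|v| on matrices is the sup norm; Euclidean norms are
   therefore written with dotv or mnorm. *)
Definition mnorm (R : realType) (d : nat) (M : 'M[R]_d) (v : 'cV[R]_d) : R :=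
  Num.sqrt (dotv v (M *m v)).

Definition gradient (R : realType) (d : nat) (f : 'cV[R]_d -> R)
    (w : 'cV[R]_d) : 'cV[R]_d :=
  \col_i derive f w (delta_mx i 0).

Definition hessian (R : realType) (d : nat) (f : 'cV[R]_d -> R)
    (w : 'cV[R]_d) : 'M[R]_d :=
  \matrix_(i, j) derive (fun v => derive f v (delta_mx i 0)) w (delta_mx j 0).

Definition convex_on_line (R : realType) (f : R -> R) : Prop :=
  @convex_function R R^o [set: R] f.

Definition twice_differentiable (R : realType) (f : R -> R) : Prop :=
  (forall u, derivable f u 1) /\ (forall u, derivable (derive1 f) u 1).

Definition smooth (R : realType) (f : R -> R) : Prop :=
  lipschitz (derive1 f).

Definition loss (R : realType) (n d : nat) (x : 'I_n -> 'cV[R]_d)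
    (l : 'I_n -> R -> R) (lambda : R) (w : 'cV[R]_d) : R :=
  n%:R^-1 * (\sum_(i < n) l i (dotv w (x i))) + lambda / 2 * dotv w w.

Definition subsampled_loss (R : realType) (n d : nat) (x : 'I_n -> 'cV[R]_d)
    (l : 'I_n -> R -> R) (lambda k : R) (b : 'I_n -> bool)
    (w : 'cV[R]_d) : R :=
  k^-1 * (\sum_(i < n) (b i)%:R * l i (dotv w (x i)))
    + lambda / 2 * dotv w w.

(* The seed 0 of the maximum is harmless: the second derivatives of the convex
   functions l i are nonnegative. *)
Definition coherence (R : realType) (n d : nat) (x : 'I_n -> 'cV[R]_d)
    (l : 'I_n -> R -> R) (lambda : R) (w : 'cV[R]_d) : R :=
  d%:R^-1 *
  \big[Num.max/0]_(i < n)
    (derive1n 2 (l i) (dotv w (x i)) *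
     mnorm (invmx (hessian (loss x l lambda) w)) (x i) ^+ 2).

Definition mutually_independent (R : realType) (disp disp' : measure_display)
    (T : measurableType disp) (T' : measurableType disp')
    (P : probability T R) (I : finType) (X : I -> {RV P >-> T'}) : Prop :=
  forall (J : {set I}) (A : I -> set T'),
    (forall i, measurable (A i)) ->
    (P (\bigcap_(i in [set` J]) (X i @^-1` A i))
     = \prod_(i in J) P (X i @^-1` A i))%E.

(* Main.v *)
Require Import Defs.
From mathcomp Require Import ring lra.

(* Idea.  Write the Hessian [H] of the loss as [N N^T] and conjugate by [N^-1]:
   every subsampled Hessian becomes [A = B0 + k^-1 \sum_i b_i v_i v_i^T] with
   [E A = 1] and [|v_i|^2 <= mu d], and the error vector becomes
   [(\sum_t Z_t) / (\sum_t \det A_t)] with [Z = adj(A) g - \det(A) g].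
   The determinant is affine in each [b_i], so [E \det A = 1], and
   [h^T adj(A) g = \det (A + g h^T) - \det A] gives [E Z = 0].  Since
   [\det A <= exp (tr A - d)] for positive definite [A], the adjugate is bounded
   by [exp (tr A - d + 1)] even when [A] is nearly singular, so that
   [|Z| <= exp (tr A - d + 1) |(A - 1) g|].  This bounds the moments of [Z] of
   order about [ln (d / delta)]; the corresponding moments of [\sum_t Z_t]
   follow from a Rosenthal-type inequality, and Markov's inequality gives the
   tail.  The denominator is bounded below by
   [1 - \det A <= 4 |A - 1|_F^2 + |tr A - d|] and the same moment method. *)

Set Implicit Arguments.
Unset Strict Implicit.
Unset Printing Implicit Defensive.

Import Order.TTheory GRing.Theory Num.Theory.
Import numFieldNormedType.Exports.

Local Open Scope classical_set_scope.
Local Open Scope ring_scope.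

(** * Expectations over finite product spaces *)

Section FiniteExpectation.
Variable R : realType.
Implicit Types (U I : finType).

(** Restricting to an event on which [A] is close to 1 would destroy the exact identities
    [E \det A = 1] and [E Z = 0], and the gain [1 / sqrt m] rests on that centering. Hence every
    estimate is a moment of an unconditioned variable, and it has to hold for nearly singular and
    for large [A] as well. The exponents in the condition on [k] arise as follows. Let [eps] bound
    [|v_i|^2 / k], so that it is of order [mu d / k], and let [2r] be the order of the moments, with
    [r] about [ln (d / delta)]. The residual [(A - 1) g] has squared size [r eps |g|^2], without a
    factor [d]. Each coordinate of [Z] is bounded by the whole norm, so that summing the [d]
    coordinates costs [d]; this gives [mu d^2 / k]. Passing from [Z] to a sum of independent copies
    costs [r^2], which completes the cube of the logarithm. All expectations are finite sums over
    bit patterns; the given probability space enters only through the weight of each pattern. *)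

Definition expect U (p : U -> R) (h : U -> R) : R := \sum_u p u * h u.

Definition weights U (p : U -> R) := (forall u, 0 <= p u) /\ \sum_u p u = 1.

Definition iid_weight I U (p : U -> R) (f : {ffun I -> U}) : R :=
  \prod_i p (f i).

Definition resample I U (f : {ffun I -> U}) i u : {ffun I -> U} :=
  [ffun j => if j == i then u else f j].

Lemma expectD U (p : U -> R) h1 h2 :
  expect p (fun u => h1 u + h2 u) = expect p h1 + expect p h2.
Proof. by rewrite -big_split; apply: eq_bigr => u _; rewrite mulrDr. Qed.

Lemma expectZ U (p : U -> R) c h :
  expect p (fun u => c * h u) = c * expect p h.
Proof. by rewrite mulr_sumr; apply: eq_bigr => u _; rewrite mulrCA. Qed.

Lemma expect_sum U (p : U -> R) (J : Type) (r : seq J) (P : pred J) h :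
  expect p (fun u => \sum_(j <- r | P j) h j u)
  = \sum_(j <- r | P j) expect p (h j).
Proof.
by rewrite exchange_big; apply: eq_bigr => u _; rewrite mulr_sumr.
Qed.

Lemma eq_expect U (p : U -> R) h1 h2 :
  h1 =1 h2 -> expect p h1 = expect p h2.
Proof. by move=> e; apply: eq_bigr => u _; rewrite e. Qed.

Section Weights.
Variables (U : finType) (p : U -> R).
Hypothesis pw : weights p.

Lemma expect_cst c : expect p (fun=> c) = c.
Proof. by rewrite /expect -mulr_suml pw.2 mul1r. Qed.

Lemma expect_ge0 h : (forall u, 0 <= h u) -> 0 <= expect p h.
Proof. by move=> h0; apply: sumr_ge0 => u _; rewrite mulr_ge0 ?pw.1. Qed.

Lemma expect_le h1 h2 : (forall u, h1 u <= h2 u) -> expect p h1 <= expect p h2.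
Proof. by move=> h0; apply: ler_sum => u _; rewrite ler_wpM2l ?pw.1. Qed.

Lemma ler_norm_expect h : `|expect p h| <= expect p (fun u => `|h u|).
Proof.
apply: le_trans (ler_norm_sum _ _ _) _; apply: ler_sum => u _.
by rewrite normrM (ger0_norm (pw.1 u)).
Qed.

Lemma expect_markov (h : U -> R) (c : R) (Q : pred U) :
  (forall u, 0 <= h u) -> (forall u, Q u -> c <= h u) ->
  c * (\sum_(u | Q u) p u) <= expect p h.
Proof.
move=> h0 hQ; rewrite mulr_sumr /expect [leRHS](bigID Q) /= -[leLHS]addr0.
apply: lerD; last by apply: sumr_ge0 => u _; rewrite mulr_ge0 ?pw.1.
by apply: ler_sum => u Qu; rewrite mulrC ler_wpM2l ?pw.1 ?hQ.
Qed.

Lemma weights_iid (I : finType) : weights (@iid_weight I U p).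
Proof.
split=> [f|]; first by apply: prodr_ge0 => i _; apply: pw.1.
by rewrite /iid_weight -(bigA_distr_bigA (fun _ u => p u)) pw.2 big1.
Qed.

Lemma expect_iid_prod (I : finType) (h : I -> U -> R) :
  expect (@iid_weight I U p) (fun f => \prod_i h i (f i))
  = \prod_i expect p (h i).
Proof.
rewrite /expect (bigA_distr_bigA (fun i u => p u * h i u)) /=.
by apply: eq_bigr => f _; rewrite big_split.
Qed.

(** Isolates coordinate [i] as an independent draw: exchanging [f i] with a fresh [u] is an
    involution on pairs that preserves their product weight. *)
Lemma expect_resample (I : finType) (i : I) (F : {ffun I -> U} -> R) :
  expect (iid_weight p) F
  = expect (iid_weight p) (fun f => expect p (fun u => F (resample f i u))).
Proof.
pose swap (x : {ffun I -> U} * U) := (resample x.1 i x.2, x.1 i).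
have swapK : involutive swap.
  move=> [f u]; rewrite /swap /=; congr pair; last by rewrite ffunE eqxx.
  by apply/ffunP => j; rewrite !ffunE; case: eqP => // ->.
have -> : expect (iid_weight p) F
    = \sum_f \sum_u iid_weight p f * p u * F f.
  apply: eq_bigr => f _; rewrite -mulr_suml -mulr_sumr pw.2.
  by rewrite mulr1.
rewrite pair_big /= (reindex_inj (inv_inj swapK)) /=.
under [RHS]eq_bigr => f _ do rewrite mulr_sumr.
rewrite pair_big /=; apply: eq_bigr => -[f u] _ /=.
rewrite mulrA; congr (_ * _); rewrite /iid_weight.
rewrite (bigD1 i) //= [in RHS](bigD1 i) //= ffunE eqxx.
rewrite mulrC mulrA [RHS]mulrAC; congr (_ * _).
by apply: eq_bigr => j /negbTE ji; rewrite ffunE ji.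
Qed.

End Weights.

Lemma expect_iid_marginal U (p : U -> R) (pw : weights p) (I : finType) (i : I)
    (h : U -> R) :
  expect (@iid_weight I U p) (fun f => h (f i)) = expect p h.
Proof.
rewrite (expect_resample pw i) -[RHS](expect_cst (weights_iid pw I)).
by apply: eq_expect => f; apply: eq_expect => u; rewrite ffunE eqxx.
Qed.

(* The factor [1 + v i] majorizes the exponential generating function
   [E exp (s X i)], truncated at order [N] and with moments replaced by their
   absolute values; the order-one term is absent because [X i] is centered. *)
Lemma moment_sum_le U (p : U -> R) (pw : weights p) (I : finType)
    (X : I -> U -> R) (v : I -> R) (s : R) (N : nat) (r : seq I) :
  0 < s -> uniq r -> (forall i, expect p (X i) = 0) ->
  (forall i, \sum_(2 <= a < N.+1)
     s ^+ a * `|expect p (fun u => X i u ^+ a)| / a`!%:R <= v i) ->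
  forall j, (j <= N)%N ->
  `|expect (iid_weight p) (fun f => (\sum_(i <- r) X i (f i)) ^+ j)|
  <= j`!%:R * s ^- j * \prod_(i <- r) (1 + v i).
Proof.
move=> s0 + cX hv; elim: r => [|i r IH] /=.
  move=> _ j _; under eq_expect do rewrite big_nil.
  rewrite big_nil (expect_cst (weights_iid pw I)) mulr1.
  case: j => [|j]; first by rewrite expr0 normr1 fact0 expr0 invr1 mulr1.
  by rewrite expr0n /= normr0 mulr_ge0 // invr_ge0 exprn_ge0 // ltW.
move=> /andP[ir ur] j jN.
have v0 i' : 0 <= v i'.
  apply: le_trans (hv i'); apply: sumr_ge0 => a _.
  by rewrite !mulr_ge0 ?invr_ge0 ?exprn_ge0 // ltW.
set G := \prod_(i <- r) (1 + v i) in IH *.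
have G0 : 0 <= G by apply: prodr_ge0 => i' _; rewrite addr_ge0.
(* The binomial formula separates [X i] from the remaining sum, which does not see coordinate [i]
   because the list is duplicate-free. *)
have step : expect (iid_weight p)
      (fun f => (\sum_(i <- i :: r) X i (f i)) ^+ j)
    = \sum_(a < j.+1) 'C(j, a)%:R * (expect p (fun u => X i u ^+ a) *
      expect (iid_weight p) (fun f => (\sum_(i <- r) X i (f i)) ^+ (j - a))).
  under eq_expect => f do rewrite big_cons addrC exprDn.
  rewrite expect_sum; apply: eq_bigr => a _.
  under eq_expect => f do rewrite -mulr_natl.
  rewrite expectZ; congr (_ * _); rewrite (expect_resample pw i).
  rewrite -expectZ; apply: eq_expect => f.
  rewrite mulrC -expectZ; apply: eq_expect => u.
  rewrite ffunE eqxx; congr (_ * _); congr (_ ^+ _).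
  apply: eq_big_seq => i' i'r; rewrite ffunE; case: eqP => // ii.
  by move: ir; rewrite -ii i'r.
rewrite step big_cons -/G; apply: le_trans (ler_norm_sum _ _ _) _.
pose c a := s ^+ a * `|expect p (fun u => X i u ^+ a)| / a`!%:R.
have c0 a : 0 <= c a by rewrite !mulr_ge0 ?invr_ge0 ?exprn_ge0 // ltW.
have -> : j`!%:R * s ^- j * ((1 + v i) * G) = j`!%:R * s ^- j * G * (1 + v i).
  by ring.
(* Binomial coefficients and factorials cancel exactly, as in a Cauchy product of exponential
   generating functions. *)
apply: (@le_trans _ _ (\sum_(a < j.+1) j`!%:R * s ^- j * G * c a)).
  apply: ler_sum => a _; rewrite !normrM normr_nat.
  have aj : (a <= j)%N by rewrite -ltnS.
  have /IH : (j - a <= N)%N by apply: leq_trans (leq_subr _ _) jN.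
  move=> /(_ ur) IHa.
  apply: (@le_trans _ _ ('C(j, a)%:R * (`|expect p (fun u => X i u ^+ a)| *
      ((j - a)`!%:R * s ^- (j - a) * G)))).
    by rewrite !ler_wpM2l.
  rewrite /c -(bin_fact aj) !natrM.
  have -> : s ^- j = s ^- (j - a) * s ^- a.
    by rewrite -invfM -exprD subnK.
  have sa : s ^+ a != 0 by rewrite expf_neq0 // gt_eqF.
  have sja : s ^+ (j - a) != 0 by rewrite expf_neq0 // gt_eqF.
  have af : (a`!%:R : R) != 0 by rewrite pnatr_eq0 -lt0n fact_gt0.
  rewrite le_eqVlt; apply/orP; left; apply/eqP; field.
  by rewrite sja sa af.
rewrite -mulr_sumr ler_wpM2l ?mulr_ge0 ?invr_ge0 ?exprn_ge0 //; first by rewrite ltW.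
rewrite -(big_mkord xpredT) /=.
have c00 : c 0%N = 1.
  rewrite /c expr0 fact0 mul1r divr1.
  under eq_expect do rewrite expr0.
  by rewrite expect_cst // normr1.
have c10 : c 1%N = 0.
  rewrite /c; under eq_expect do rewrite expr1.
  by rewrite cX normr0 mulr0 mul0r.
rewrite big_ltn // c00 lerD2l; case: j jN {IH step} => [|j] jN.
  by rewrite big_geq.
rewrite big_ltn // c10 add0r; apply: le_trans (hv i).
rewrite [leRHS](@big_cat_nat _ _ _ j.+2) //= lerDl.
by apply: sumr_ge0 => a _; apply: c0.
Qed.

End FiniteExpectation.

(** * Moments of Bernoulli sums *)

Section RealInequalities.
Variable R : realType.
Implicit Types (x y : R) (r N : nat).

Lemma expR1_le4 : expR 1 <= 4 :> R.
Proof.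
have h : 2^-1 <= expR (- 2^-1) :> R by apply: le_trans (expR_ge1Dx _); lra.
have -> : 1 = 2%:R * 2^-1 :> R by rewrite divff.
rewrite expRM_natl -[X in X ^+ 2]invrK -expRN.
have : (expR (- 2^-1))^-1 <= 2 :> R.
  by rewrite -[leRHS]invrK lef_pV2 // posrE ?expR_gt0 ?invr_gt0.
have := expR_gt0 (- 2^-1 : R); rewrite -invr_gt0.
move: (expR _)^-1 => z; nra.
Qed.

Lemma expR_nat_le r : expR r%:R <= 4 ^+ r :> R.
Proof.
by rewrite -[r%:R]mulr1 expRM_natl lerXn2r ?nnegrE ?expR_ge0 // expR1_le4.
Qed.

(** [exp x (1 - x) <= 1], whereas [(1 + x + 2 x^2) (1 - x) = 1 + x^2 (1 - 2 x) >= 1]. *)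
Lemma expR_le_quadratic x : x <= 2^-1 -> expR x <= 1 + x + 2 * x ^+ 2.
Proof.
move=> x2; have e0 := expR_gt0 x.
have : expR x * (1 - x) <= 1.
  by rewrite -[leRHS](expRxMexpNx_1 x) ler_wpM2l ?expR_ge1Dx // ltW.
move: (expR x) e0 => e e0 h.
have d0 : 0 < 1 - x by lra.
rewrite -(ler_pM2r d0) (le_trans h) //.
have : 0 <= x ^+ 2 * (1 - 2 * x) by rewrite mulr_ge0 ?sqr_ge0; lra.
nra.
Qed.

Lemma prod_1D_le_expR (I : Type) (s : seq I) (v : I -> R) :
  (forall i, 0 <= v i) ->
  \prod_(i <- s) (1 + v i) <= expR (\sum_(i <- s) v i).
Proof.
move=> v0; rewrite expR_sum; apply: ler_prod => i _.
by rewrite addr_ge0 ?expR_ge1Dx.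
Qed.

(** The subtracted term lets the induction close, because [2 / (N+2)! <= 1 / (N+1)!]. *)
Lemma sum_inv_fact_le1 N :
  \sum_(2 <= a < N.+2) (a`!%:R)^-1 <= 1 - (N.+1`!%:R)^-1 :> R.
Proof.
elim: N => [|N IH]; first by rewrite big_geq // factS fact0 invr1 subrr.
rewrite big_nat_recr //=.
have : (N.+1`!%:R)^-1 = N.+2%:R * (N.+2`!%:R)^-1 :> R.
  rewrite [N.+2`!]factS natrM; field.
  by rewrite -natrD !pnatr_eq0 -lt0n fact_gt0.
have : 0 <= (N.+2`!%:R)^-1 :> R by rewrite invr_ge0.
have : 2 <= N.+2%:R :> R by rewrite ler_nat.
move: IH; move: (\sum_(_ <= _ < _) _) => S; move: (_^-1) => A.
move: (N.+2`!%:R^-1) => B; move: (N.+2%:R : R) => c; nra.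
Qed.

Lemma fact_le_pow N : (N`! <= N ^ N)%N.
Proof.
elim: N => // N IH; rewrite factS expnS leq_mul2l /=.
by case: N IH => // N IH; apply: leq_trans IH _; rewrite leq_exp2r.
Qed.

Lemma pow_ge_tangent r x y : 0 <= x -> 0 <= y ->
  x ^+ r + r%:R * x ^+ r.-1 * (y - x) <= y ^+ r.
Proof.
move=> x0 y0; elim: r => [|r IH]; first by rewrite !expr0 !mul0r addr0.
rewrite [leRHS]exprS; apply: le_trans (ler_wpM2l y0 IH).
rewrite -subr_ge0 /=; case: r {IH} => [|r].
  by rewrite !expr0 expr1 /=; lra.
have -> : y * (x ^+ r.+1 + r.+1%:R * x ^+ r.+1.-1 * (y - x)) -
   (x ^+ r.+2 + r.+2%:R * x ^+ r.+1 * (y - x))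
   = r.+1%:R * x ^+ r * (y - x) ^+ 2.
  by rewrite /= !exprS -!natr1; ring.
by rewrite mulr_ge0 ?sqr_ge0 // mulr_ge0 ?exprn_ge0.
Qed.

(** Jensen's inequality, by averaging the tangent to [y ^ r] at the mean, whose linear term then
    vanishes. *)
Lemma expect_pow_le (U : finType) (p : U -> R) (h : U -> R) r :
  weights p -> (forall u, 0 <= h u) ->
  expect p h ^+ r <= expect p (fun u => h u ^+ r).
Proof.
move=> pw h0; set M := expect p h.
have M0 : 0 <= M by apply: expect_ge0.
have -> : M ^+ r = expect p (fun u => M ^+ r + r%:R * M ^+ r.-1 * (h u - M)).
  rewrite expectD expect_cst // expectZ expectD expect_cst //.
  by rewrite -/M subrr mulr0 addr0.
by apply: expect_le => // u; apply: pow_ge_tangent.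
Qed.

End RealInequalities.

Section BernoulliMoments.
Variable R : realType.

Definition bernoulli_weight (q : R) (b : bool) : R := if b then q else 1 - q.

Lemma expect_bernoulli q (h : bool -> R) :
  expect (bernoulli_weight q) h = q * h true + (1 - q) * h false.
Proof. by rewrite /expect big_bool. Qed.

Lemma weights_bernoulli q : 0 <= q <= 1 -> weights (bernoulli_weight q).
Proof.
move=> /andP[q0 q1]; split=> [[]|]; rewrite ?big_bool /bernoulli_weight /=; lra.
Qed.

(** Since [|b - q| <= 1], higher powers are dominated by the square, and the variance is
    [q (1 - q) <= q]. *)
Lemma bernoulli_moment_le q a : 0 <= q <= 1 -> (2 <= a)%N ->
  `|expect (bernoulli_weight q) (fun b => (b%:R - q) ^+ a)| <= q.
Proof.
move=> /andP[q0 q1] a2.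
have small (y : R) : `|y| <= 1 -> `|y ^+ a| <= y ^+ 2.
  move=> y1; rewrite normrX -[leRHS]ger0_norm ?sqr_ge0 // normrX.
  by rewrite -(subnK a2) exprD ler_piMl ?exprn_ge0 // exprn_ile1.
rewrite expect_bernoulli; apply: le_trans (ler_normD _ _) _.
have q1' : 0 <= 1 - q by lra.
rewrite !normrM (ger0_norm q0) (ger0_norm q1').
have h1 : `|(true%:R - q) ^+ a| <= (1 - q) ^+ 2.
  by apply: small; rewrite ler_norml /=; apply/andP; split; lra.
have h2 : `|(false%:R - q) ^+ a| <= (0 - q) ^+ 2.
  by apply: small; rewrite ler_norml /=; apply/andP; split; lra.
apply: (@le_trans _ _ (q * (1 - q) ^+ 2 + (1 - q) * (0 - q) ^+ 2)).
  by apply: lerD; apply: ler_wpM2l => //; lra.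
nra.
Qed.

Variables (I : finType) (q : R).
Hypothesis q01 : 0 <= q <= 1.

Let pw := weights_bernoulli q01.

(** A Bernstein-type bound: [tau] collects the variance and the correction [r B^2]. With
    [s^2 = r / tau], each [s c_i] has size at most 1 and the product of the [1 + v i] is at most
    [exp r <= 4^r], which leaves [((2r)^2 (tau / r) 4)^r]. *)
Lemma bernoulli_sum_moment (c : I -> R) (B tau : R) (r : nat) :
  (0 < r)%N -> 0 < tau -> (forall i, `|c i| <= B) ->
  q * (\sum_i c i ^+ 2) + r%:R * B ^+ 2 <= tau ->
  expect (iid_weight (bernoulli_weight q))
    (fun f : {ffun I -> bool} =>
       (\sum_i ((f i)%:R - q) * c i) ^+ (2 * r)%N)
  <= (16 * r%:R * tau) ^+ r.
Proof.
move=> r0 tau0 cB htau; have [q0 q1] := andP q01.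
have r0' : 0 < r%:R :> R by rewrite ltr0n.
pose s := Num.sqrt (r%:R / tau).
have s2 : s ^+ 2 = r%:R / tau by rewrite sqr_sqrtr // divr_ge0 // ltW.
have s0 : 0 < s by rewrite sqrtr_gt0 divr_gt0.
have sumc0 : 0 <= \sum_i c i ^+ 2 by apply: sumr_ge0 => i _; apply: sqr_ge0.
have sc i : `|s * c i| <= 1.
  rewrite -(@expr_le1 _ 2) // -normrX ger0_norm ?sqr_ge0 // exprMn s2.
  rewrite mulrAC ler_pdivrMr // mul1r.
  have : c i ^+ 2 <= B ^+ 2.
    rewrite -[c i ^+ 2]ger0_norm ?sqr_ge0 // normrX lerXn2r ?nnegrE //.
    exact: le_trans (cB i).
  by nra.
pose v i := q * c i ^+ 2 * s ^+ 2.
have v0 i : 0 <= v i by rewrite mulr_ge0 ?sqr_ge0 // mulr_ge0 ?sqr_ge0.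
have := @moment_sum_le R bool (bernoulli_weight q) pw I
  (fun i b => (b%:R - q) * c i) v s (2 * r) (index_enum I) s0
  (index_enum_uniq _).
have cX i : expect (bernoulli_weight q) (fun b => (b%:R - q) * c i) = 0.
  by rewrite expect_bernoulli /=; ring.
move=> /(_ cX); have hv i : \sum_(2 <= a < (2 * r).+1) s ^+ a *
    `|expect (bernoulli_weight q) (fun b => ((b%:R - q) * c i) ^+ a)| / a`!%:R
    <= v i.
  apply: (@le_trans _ _ (v i * \sum_(2 <= a < (2 * r).+1) (a`!%:R)^-1)).
    rewrite mulr_sumr big_nat [leRHS]big_nat; apply: ler_sum => a /andP[a2 _].
    rewrite ler_wpM2r ?invr_ge0 //.
    under eq_expect do rewrite exprMn mulrC.
    rewrite expectZ normrM mulrA.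
    have -> : s ^+ a * `|c i ^+ a| = `|s * c i| ^+ a.
      by rewrite normrM (gtr0_norm s0) exprMn normrX.
    have -> : v i = `|s * c i| ^+ 2 * q.
      by rewrite -normrX ger0_norm ?sqr_ge0 // /v; ring.
    apply: ler_pM; rewrite ?exprn_ge0 ?bernoulli_moment_le //.
    by rewrite -(subnK a2) exprD ler_piMl ?exprn_ge0 // exprn_ile1.
  rewrite ler_piMr //.
  case: (r) r0 => // r' _; rewrite mulnS add2n.
  by apply: le_trans (sum_inv_fact_le1 _ _) _; rewrite lerBlDr lerDl invr_ge0.
move=> /(_ hv (2 * r)%N (leqnn _)); rewrite ger0_norm; last first.
  apply: (expect_ge0 (weights_iid pw I)) => f.
  by rewrite exprM exprn_ge0 // sqr_ge0.
move=> /le_trans; apply.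
apply: (@le_trans _ _ ((2 * r)%:R ^+ (2 * r) * s ^- (2 * r) * 4 ^+ r)).
  apply: ler_pM; rewrite ?mulr_ge0 ?invr_ge0 ?exprn_ge0 ?(ltW s0) //.
  - by apply: prodr_ge0 => i _; rewrite addr_ge0.
  - rewrite ler_wpM2r ?invr_ge0 ?exprn_ge0 ?(ltW s0) //.
    by rewrite -natrX ler_nat fact_le_pow.
  apply: le_trans (prod_1D_le_expR _ v0) _; apply: le_trans (expR_nat_le _ r).
  rewrite ler_expR /v -mulr_suml -mulr_sumr s2 mulrA ler_pdivrMr //.
  by rewrite mulrC ler_wpM2l // (le_trans _ htau) // lerDl mulr_ge0 ?sqr_ge0.
rewrite !exprM s2 -exprVn -!exprMn le_eqVlt; apply/orP; left; apply/eqP.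
congr (_ ^+ _); rewrite natrM invf_div; field; lra.
Qed.

(* Power mean inequality with weights proportional to the variance proxies
   [tau j]: uniform weights would lose a factor [#|J|]. *)
Lemma bernoulli_vector_moment (J : finType) (j0 : J) (u : I -> J -> R)
    (B sigma : R) (r : nat) :
  (0 < r)%N -> 0 < B -> (forall i j, `|u i j| <= B) ->
  q * (\sum_i \sum_j u i j ^+ 2) <= sigma ->
  expect (iid_weight (bernoulli_weight q))
    (fun f : {ffun I -> bool} =>
       (\sum_j (\sum_i ((f i)%:R - q) * u i j) ^+ 2) ^+ r)
  <= (16 * r%:R * (sigma + #|J|%:R * (r%:R * B ^+ 2))) ^+ r.
Proof.
move=> r0 B0 uB hsigma; have [q0 q1] := andP q01.
have r0' : 0 < r%:R :> R by rewrite ltr0n.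
pose tau j := q * (\sum_i u i j ^+ 2) + r%:R * B ^+ 2.
have tau0 j : 0 < tau j.
  rewrite ltr_wpDl ?mulr_gt0 ?exprn_gt0 // mulr_ge0 //.
  by apply: sumr_ge0 => i _; apply: sqr_ge0.
pose T := \sum_j tau j.
have T0 : 0 < T.
  by rewrite /T (bigD1 j0) //= ltr_pwDl // sumr_ge0 // => j _; apply: ltW.
have TE : T <= sigma + #|J|%:R * (r%:R * B ^+ 2).
  rewrite /T big_split /= sumr_const -mulr_sumr exchange_big /=.
  rewrite [X in _ + X <= _](_ : _ = #|J|%:R * (r%:R * B ^+ 2)).
    by rewrite lerD2r.
  by rewrite [RHS]mulr_natl; congr (_ *+ _); apply: eq_card.
pose p j := tau j / T.
have pw' : weights p.
  split=> [j|]; first by rewrite divr_ge0 ?ltW.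
  by rewrite -mulr_suml divff // gt_eqF.
apply: (@le_trans _ _ ((16 * r%:R * T) ^+ r)); last first.
  rewrite lerXn2r ?nnegrE ?mulr_ge0 ?(ltW T0) //.
    exact: le_trans (ltW T0) TE.
  by rewrite ler_wpM2l ?mulr_ge0.
pose S (f : {ffun I -> bool}) j := \sum_i ((f i)%:R - q) * u i j.
apply: (@le_trans _ _ (expect (iid_weight (bernoulli_weight q))
    (fun f => T ^+ r * expect p (fun j => (tau j)^-1 ^+ r * S f j ^+ (2 * r))))).
  apply: (expect_le (weights_iid pw I)) => f.
  have -> : \sum_j (\sum_i ((f i)%:R - q) * u i j) ^+ 2
      = T * expect p (fun j => (tau j)^-1 * S f j ^+ 2).
    rewrite /expect mulr_sumr; apply: eq_bigr => j _; rewrite /p /S.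
    by field; rewrite !gt_eqF.
  rewrite exprMn ler_wpM2l ?exprn_ge0 ?(ltW T0) //.
  under [leRHS]eq_expect => j do rewrite exprM -exprMn.
  by apply: expect_pow_le => // j; rewrite mulr_ge0 ?sqr_ge0 ?invr_ge0 ?ltW.
rewrite expectZ [leRHS]exprMn mulrC ler_wpM2r ?exprn_ge0 ?(ltW T0) //.
rewrite /expect.
under eq_bigr do rewrite mulr_sumr.
rewrite exchange_big /= -[leRHS](expect_cst pw'); apply: ler_sum => j _.
rewrite (_ : \sum__ _ = p j * ((tau j)^-1 ^+ r *
    expect (iid_weight (bernoulli_weight q)) (fun f => S f j ^+ (2 * r)%N)));
  last first.
  rewrite /expect !mulr_sumr; apply: eq_bigr => f _; ring.
rewrite ler_wpM2l ?pw'.1 //.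
have := @bernoulli_sum_moment (fun i => u i j) B (tau j) r r0 (tau0 j)
  (fun i => uB i j) (lexx _).
rewrite [X in _ <= X -> _]exprMn => h; rewrite exprVn mulrC ler_pdivrMr //.
by rewrite exprn_gt0.
Qed.

(** The coordinates factor; the quadratic bound on [exp] loses its linear term by centering, and
    [1 + y <= exp y] recombines the factors. *)
Lemma bernoulli_sum_mgf (c : I -> R) :
  (forall i, `|c i| <= 2^-1) ->
  expect (iid_weight (bernoulli_weight q))
    (fun f : {ffun I -> bool} => expR (\sum_i ((f i)%:R - q) * c i))
  <= expR (2 * (q * (\sum_i c i ^+ 2))).
Proof.
move=> c1; have [q0 q1] := andP q01.
under eq_expect do rewrite expR_sum.
rewrite (expect_iid_prod _ (fun i (b : bool) => expR ((b%:R - q) * c i))).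
rewrite !mulr_sumr expR_sum; apply: ler_prod => i _.
rewrite (expect_ge0 pw) /=; last by move=> u; apply: expR_ge0.
have := c1 i; rewrite ler_norml => /andP[c2 c3].
apply: (@le_trans _ _ (expect (bernoulli_weight q) (fun b =>
   1 + (b%:R - q) * c i + 2 * ((b%:R - q) * c i) ^+ 2))).
  apply: (expect_le pw) => -[]; apply: expR_le_quadratic => /=; nra.
rewrite expect_bernoulli /=; apply: le_trans (expR_ge1Dx _).
have := sqr_ge0 (c i); nra.
Qed.

End BernoulliMoments.

(** Centering makes the moment grow like [m^r] rather than [m^(2r)]. Only one moment of [Z] is
    available and no uniform bound; the price is the factor [(2r)^2], where a Bernstein bound pays a
    multiple of [r]. *)
Lemma iid_sum_moment (R : realType) (U : finType) (p : U -> R) (Z : U -> R)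
    (tau : R) (r m : nat) :
  weights p -> (0 < r)%N -> (0 < m)%N -> 0 < tau -> expect p Z = 0 ->
  expect p (fun u => Z u ^+ (2 * r)%N) <= tau ^+ r ->
  expect (iid_weight p)
    (fun f : {ffun 'I_m -> U} => (\sum_t Z (f t)) ^+ (2 * r)%N)
  <= 16 * ((2 * r)%:R ^+ 2 * (m%:R * tau)) ^+ r.
Proof.
move=> pw r0 m0 tau0 Z0 Zr.
have m0' : 0 < m%:R :> R by rewrite ltr0n.
pose a := Num.sqrt tau; pose b := Num.sqrt (m%:R : R)^-1.
have a0 : 0 < a by rewrite sqrtr_gt0.
have a2 : a ^+ 2 = tau by rewrite sqr_sqrtr // ltW.
have b0 : 0 < b by rewrite sqrtr_gt0 invr_gt0.
have b2 : b ^+ 2 = m%:R^-1 by rewrite sqr_sqrtr // ltW // invr_gt0.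
have b1 : b <= 1.
  by rewrite -(@expr_le1 _ 2) // ?(ltW b0) // b2 invf_le1 // ler1n.
(* The lower moments are controlled through [y^l <= 1 + y^(2r)] for [y = |Z| / a]. *)
have mom l : (l <= 2 * r)%N -> `|expect p (fun u => Z u ^+ l)| <= 2 * a ^+ l.
  move=> lr; apply: le_trans (ler_norm_expect pw _) _.
  apply: (@le_trans _ _ (expect p (fun u => a ^+ l * (1 + tau ^- r * Z u ^+ (2 * r))))).
    apply: (expect_le pw) => u; rewrite normrX.
    have -> : `|Z u| = a * (`|Z u| / a) by field; rewrite gt_eqF.
    rewrite exprMn ler_wpM2l ?exprn_ge0 ?(ltW a0) //.
    have -> : tau ^- r * Z u ^+ (2 * r) = (`|Z u| / a) ^+ (2 * r).
      rewrite !exprM expr_div_n a2 -[`|_| ^+ 2]normrX ger0_norm ?sqr_ge0 //.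
      by rewrite expr_div_n mulrC.
    have : 0 <= `|Z u| / a by rewrite divr_ge0 // ltW.
    move: (_ / _) => y y0; have [y1|y1] := lerP y 1.
      by rewrite (@le_trans _ _ 1) ?exprn_ile1 // lerDl exprn_ge0.
    by rewrite (le_trans (ler_weXn2l (ltW y1) lr)) // lerDr.
  rewrite expectZ mulrC ler_wpM2r ?exprn_ge0 ?(ltW a0) // expectD expect_cst //.
  rewrite expectZ (_ : 2 = 1 + 1) // lerD2l mulrC ler_pdivrMr ?mul1r //.
  by rewrite exprn_gt0.
(* As [s a = m^(-1/2) <= 1], every term of order [l >= 2] is at most [(2 / m) / l!]; the product of
   [m] factors [1 + 2 / m] is then at most [e^2 <= 16]. *)
pose s := b / a.
have s0 : 0 < s by rewrite divr_gt0.
have hv (t : 'I_m) : \sum_(2 <= l < (2 * r).+1)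
    s ^+ l * `|expect p (fun u => Z u ^+ l)| / l`!%:R <= 2 / m%:R.
  apply: (@le_trans _ _ (2 / m%:R * \sum_(2 <= l < (2 * r).+1) (l`!%:R)^-1)).
    rewrite mulr_sumr big_nat [leRHS]big_nat.
    apply: ler_sum => l /andP[l2 lr].
    rewrite ler_wpM2r ?invr_ge0 //.
    apply: (@le_trans _ _ (s ^+ l * (2 * a ^+ l))).
      by rewrite ler_wpM2l ?mom // exprn_ge0 // ltW.
    rewrite mulrCA -exprMn divfK ?gt_eqF // ler_wpM2l // -b2.
    by rewrite ler_wiXn2l // ltW.
  rewrite ler_piMr ?divr_ge0 //.
  case: (r) r0 => // r' _; rewrite mulnS add2n.
  by apply: le_trans (sum_inv_fact_le1 _ _) _; rewrite lerBlDr lerDl invr_ge0.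
have := @moment_sum_le R U p pw 'I_m (fun=> Z) (fun=> 2 / m%:R) s (2 * r)
  (index_enum 'I_m) s0 (index_enum_uniq _) (fun=> Z0) hv (2 * r)%N (leqnn _).
rewrite ger0_norm; last first.
  apply: (expect_ge0 (weights_iid pw _)) => f.
  by rewrite exprM exprn_ge0 // sqr_ge0.
move=> /le_trans; apply.
apply: (@le_trans _ _ ((2 * r)%:R ^+ (2 * r) * s ^- (2 * r) * 16)).
  apply: ler_pM; rewrite ?mulr_ge0 ?invr_ge0 ?exprn_ge0 ?(ltW s0) //.
  - by apply: prodr_ge0 => i _; rewrite addr_ge0 ?divr_ge0.
  - rewrite ler_wpM2r ?invr_ge0 ?exprn_ge0 ?(ltW s0) //.
    by rewrite -natrX ler_nat fact_le_pow.
  apply: le_trans (prod_1D_le_expR _ _) _ => [i|].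
    by rewrite divr_ge0.
  rewrite (_ : \sum_(t <- _) _ = 2%:R); last first.
    by rewrite sumr_const card_ord -[LHS]mulr_natr divfK ?gt_eqF.
  by apply: le_trans (expR_nat_le _ 2) _; rewrite -natrX ler_nat.
rewrite !exprM /s expr_div_n a2 b2 -exprVn -!exprMn mulrC.
rewrite le_eqVlt; apply/orP; left; apply/eqP; congr (_ * _ ^+ _).
by field; rewrite !gt_eqF.
Qed.

(** * Positive definite matrices and their determinants *)

Section PositiveDefinite.
Variable R : realType.

Lemma dotvE d (u v : 'cV[R]_d) : dotv u v = \sum_i u i 0 * v i 0.
Proof. by rewrite /dotv mxE; apply: eq_bigr => i _; rewrite mxE. Qed.

Lemma dotvC d (u v : 'cV[R]_d) : dotv u v = dotv v u.
Proof. by rewrite !dotvE; apply: eq_bigr => i _; rewrite mulrC. Qed.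

Lemma dotvDr d (u v w : 'cV[R]_d) : dotv u (v + w) = dotv u v + dotv u w.
Proof. by rewrite /dotv mulmxDr mxE. Qed.

Lemma dotvZr d (a : R) (u v : 'cV[R]_d) : dotv u (a *: v) = a * dotv u v.
Proof. by rewrite /dotv -scalemxAr mxE. Qed.

Lemma dotvDl d (u v w : 'cV[R]_d) : dotv (u + v) w = dotv u w + dotv v w.
Proof. by rewrite dotvC dotvDr !(dotvC w). Qed.

Lemma dotvZl d (a : R) (u v : 'cV[R]_d) : dotv (a *: u) v = a * dotv u v.
Proof. by rewrite dotvC dotvZr dotvC. Qed.

Lemma dotv_sumr d (I : Type) (s : seq I) (P : pred I) u (F : I -> 'cV[R]_d) :
  dotv u (\sum_(i <- s | P i) F i) = \sum_(i <- s | P i) dotv u (F i).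
Proof. by rewrite /dotv mulmx_sumr summxE. Qed.

Lemma dotv_col d e (u1 v1 : 'cV[R]_d) (u2 v2 : 'cV[R]_e) :
  dotv (col_mx u1 u2) (col_mx v1 v2) = dotv u1 v1 + dotv u2 v2.
Proof. by rewrite /dotv tr_col_mx mul_row_col mxE. Qed.

Lemma dotv_ge0 d (u : 'cV[R]_d) : 0 <= dotv u u.
Proof.
by rewrite dotvE; apply: sumr_ge0 => i _; rewrite -expr2 sqr_ge0.
Qed.

Lemma dotv_eq0 d (u : 'cV[R]_d) : (dotv u u == 0) = (u == 0).
Proof.
apply/eqP/eqP => [|->]; last by rewrite /dotv mulmx0 mxE.
rewrite dotvE => /eqP; rewrite psumr_eq0; last first.
  by move=> i _; rewrite -expr2 sqr_ge0.
move=> /allP h; apply/colP => i; rewrite mxE.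
by have := h i (mem_index_enum i); rewrite mulf_eq0 orbb => /eqP.
Qed.

Lemma dotv_gt0 d (u : 'cV[R]_d) : (0 < dotv u u) = (u != 0).
Proof. by rewrite lt_def dotv_ge0 andbT dotv_eq0. Qed.

Lemma dotv_mulmx d e (A : 'M[R]_(d, e)) u v :
  dotv u (A *m v) = dotv (A^T *m u) v.
Proof. by rewrite /dotv trmx_mul trmxK mulmxA. Qed.

Lemma dotv_outer d (u v w : 'cV[R]_d) :
  dotv w (u *m v^T *m w) = dotv w u * dotv v w.
Proof.
rewrite /dotv -!mulmxA mulmxA [w^T *m u]mx11_scalar mul_scalar_mx mxE.
by rewrite !mxE.
Qed.

Definition posdef d (A : 'M[R]_d) :=
  A^T = A /\ forall u, u != 0 -> 0 < dotv u (A *m u).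

Lemma posdef_ge0 d (A : 'M[R]_d) u : posdef A -> 0 <= dotv u (A *m u).
Proof.
move=> [_ pA]; have [->|u0] := eqVneq u 0; last exact/ltW/pA.
by rewrite mulmx0 /dotv mulmx0 mxE.
Qed.

Lemma cauchy_schwarz_mx d (B : 'M[R]_d) u v : B^T = B ->
  (forall w, 0 <= dotv w (B *m w)) ->
  dotv u (B *m v) ^+ 2 <= dotv u (B *m u) * dotv v (B *m v).
Proof.
move=> sB pB; set a := dotv u (B *m u); set b := dotv u (B *m v).
set c := dotv v (B *m v).
have bE : dotv v (B *m u) = b by rewrite dotvC -{1}sB -dotv_mulmx.
have q x y : 0 <= x ^+ 2 * a + 2 * x * y * b + y ^+ 2 * c.
  have := pB (x *: u + y *: v).
  rewrite mulmxDr -!scalemxAr !(dotvDl, dotvDr, dotvZl, dotvZr) bE.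
  by rewrite -/a -/b -/c; congr (_ <= _); ring.
have a0 : 0 <= a by exact: pB.
have c0 : 0 <= c by exact: pB.
have [cz|cp] := eqVneq c 0; last first.
  have := q c (- b); have cc : 0 < c by rewrite lt_def cp.
  have -> : c ^+ 2 * a + 2 * c * - b * b + (- b) ^+ 2 * c = c * (a * c - b ^+ 2).
    by ring.
  by rewrite pmulr_rge0 // subr_ge0.
(* For [c = 0] the form is affine in [y], and this choice would give it the value -1 if [b] were
   nonzero. *)
have h1 := q 1 (- (a + 1) / 2 / b); rewrite cz in h1.
have [->|bn] := eqVneq b 0; first by rewrite cz mulr0 expr0n.
move: h1; have -> : 1 ^+ 2 * a + 2 * 1 * (- (a + 1) / 2 / b) * b +
     (- (a + 1) / 2 / b) ^+ 2 * 0 = - 1 by field.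
by rewrite ler0N1.
Qed.

Lemma cauchy_schwarz d (u v : 'cV[R]_d) :
  dotv u v ^+ 2 <= dotv u u * dotv v v.
Proof.
have := @cauchy_schwarz_mx d 1%:M u v (trmx1 _ _); rewrite !mul1mx; apply.
by move=> w; rewrite mul1mx dotv_ge0.
Qed.

(** Induction on the Schur complement of the leading entry. The triangular factor stands in for the
    spectral theorem: it yields the sign of the determinant, its bound by the trace, and the
    whitening map. *)
Lemma cholesky d (A : 'M[R]_d) : posdef A ->
  exists N : 'M[R]_d,
    [/\ is_trig_mx N, (forall i, 0 < N i i) & N *m N^T = A].
Proof.
elim: d A => [|d IH] A [sA pA].
  exists A; split=> [||]; first by apply/is_trig_mxP => -[].
    by case.
  by apply/matrixP => -[].
pose a := (A : 'M[R]_(1 + d)) 0 0.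
pose b : 'cV[R]_d := dlsubmx (A : 'M[R]_(1 + d)).
pose S : 'M[R]_d := drsubmx (A : 'M[R]_(1 + d)).
have AE : (A : 'M[R]_(1 + d)) = block_mx a%:M b^T b S.
  rewrite -[LHS](@submxK _ 1 d 1 d); congr block_mx.
    by rewrite [LHS]mx11_scalar !mxE lshift0.
  by rewrite /b trmx_dlsub sA.
have sS : S^T = S by rewrite /S trmx_drsub sA.
have quad (x : R) (v : 'cV[R]_d) :
    dotv (col_mx x%:M v : 'cV[R]_(1 + d)) ((A : 'M[R]_(1 + d)) *m col_mx x%:M v)
    = x ^+ 2 * a + 2 * x * dotv b v + dotv v (S *m v).
  have e1 (p : 'cV[R]_1) : dotv x%:M p = x * p 0 0.
    by rewrite dotvE big_ord1 mxE eqxx mulr1n.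
  rewrite AE mul_block_col dotv_col e1 dotvDr [b *m _]mul_mx_scalar dotvZr.
  rewrite -scalar_mxM mxE.
  have -> : ((a * x)%:M : 'M[R]_1) 0 0 = a * x by rewrite mxE eqxx mulr1n.
  rewrite -/(dotv b v) (dotvC v b).
  ring.
have a0 : 0 < a.
  have := pA (col_mx 1%:M 0 : 'cV[R]_(1 + d)); rewrite quad.
  rewrite mulmx0 /dotv !mulmx0 !mxE !mulr0 !addr0 expr1n mul1r; apply.
  by apply/eqP => /(congr1 (fun M : 'cV[R]_(1 + d) => usubmx M 0 0));
    rewrite col_mxKu !mxE => /eqP; rewrite oner_eq0.
pose S' := S - a^-1 *: (b *m b^T).
have pS' : posdef S'.
  split=> [|v v0].
    by rewrite /S' linearB /= linearZ /= trmx_mul trmxK sS.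
  (* This first coordinate minimizes the form for fixed [v], and the minimum is the form of the
     Schur complement at [v]. *)
  have : 0 < dotv (col_mx (- a^-1 * dotv b v)%:M v : 'cV[R]_(1 + d))
     ((A : 'M[R]_(1 + d)) *m col_mx (- a^-1 * dotv b v)%:M v).
    apply: pA; apply/eqP => /(congr1 (fun M : 'cV[R]_(1 + d) => dsubmx M)).
    rewrite col_mxKd => vv; move: v0; rewrite vv; apply/negP/negPn.
    by apply/eqP/colP => i; rewrite !mxE.
  rewrite quad /S' mulmxBl -scalemxAl dotvDr -scaleNr dotvZr dotv_outer.
  rewrite (dotvC v b); set t := dotv b v; set y := dotv v _.
  by congr (_ < _); field; rewrite gt_eqF.
have [N' [tN dN NN]] := IH _ pS'.
pose c := Num.sqrt a.
have c0 : 0 < c by rewrite sqrtr_gt0.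
have c2 : c * c = a by rewrite -expr2 sqr_sqrtr // ltW.
exists (block_mx c%:M 0 (c^-1 *: b) N' : 'M[R]_(1 + d)); split.
- rewrite (@is_trig_block_mx _ 1 d 1 d) // eqxx tN andbT /=.
  by apply/is_trig_mxP => i j; rewrite !ord1 ltnn.
- move=> i; case: (split_ordP (i : 'I_(1 + d))) => j ->.
    by rewrite (@block_mxEul _ 1 d 1 d) !ord1 mxE eqxx mulr1n.
  by rewrite (@block_mxEdr _ 1 d 1 d).
rewrite (@tr_block_mx _ 1 d 1 d) (@mulmx_block _ 1 d 1 d 1 d) [RHS]AE.
rewrite tr_scalar_mx !trmx0 !mul0mx !mulmx0 !addr0 -scalar_mxM c2.
rewrite linearZ /= mul_scalar_mx mul_mx_scalar !scalerA divff ?gt_eqF //.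
rewrite !scale1r -scalemxAl -scalemxAr scalerA -invfM c2 NN /S'.
by rewrite addrC subrK.
Qed.

Lemma posdef_det_gt0 d (A : 'M[R]_d) : posdef A -> 0 < \det A.
Proof.
move=> /cholesky[N [tN dN <-]]; rewrite det_mulmx det_tr det_trig //.
by apply: mulr_gt0; apply: prodr_gt0.
Qed.

Lemma posdef_unit d (A : 'M[R]_d) : posdef A -> A \in unitmx.
Proof. by move=> /posdef_det_gt0 h; rewrite unitmxE unitfE gt_eqF. Qed.

(** [\det A] is the product of the [N i i ^ 2], each at most [exp (N i i ^ 2 - 1)], while the trace
    is the sum of the squares of all entries of [N]. *)
Lemma posdef_det_le d (A : 'M[R]_d) :
  posdef A -> \det A <= expR (\tr A - d%:R).
Proof.
move=> /cholesky[N [tN dN <-]]; rewrite det_mulmx det_tr det_trig //.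
rewrite -big_split /=.
apply: (@le_trans _ _ (expR (\sum_i (N i i * N i i - 1)))).
  rewrite expR_sum; apply: ler_prod => i _; rewrite mulr_ge0 ?(ltW (dN i)) //=.
  by apply: le_trans (expR_ge1Dx _); rewrite addrC subrK.
rewrite ler_expR sumrB sumr_const card_ord lerB // /mxtrace.
apply: ler_sum => i _; rewrite mxE (bigD1 i) //= mxE lerDl.
by apply: sumr_ge0 => j _; rewrite mxE -expr2 sqr_ge0.
Qed.

Lemma posdef_inv d (A : 'M[R]_d) : posdef A -> posdef (invmx A).
Proof.
move=> pdA; have uA := posdef_unit pdA; have [sA pA] := pdA.
split; first by rewrite trmx_inv sA.
move=> u u0; have uE : u = A *m (invmx A *m u) by rewrite mulKVmx.
rewrite [X in dotv X _]uE dotvC; apply: pA.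
by apply: contra_neq u0 => h; rewrite uE h mulmx0.
Qed.

Lemma posdef_outerD d (A : 'M[R]_d) (u : 'cV[R]_d) : posdef A -> posdef (A + u *m u^T).
Proof.
move=> [sA pA]; split; first by rewrite linearD /= trmx_mul trmxK sA.
move=> v v0; rewrite mulmxDl dotvDr dotv_outer (dotvC v u) -expr2.
by rewrite ltr_pwDl ?sqr_ge0 ?pA.
Qed.

End PositiveDefinite.

Section RankOneUpdate.
Variables (R : realType) (d : nat).
Implicit Types (B : 'M[R]_d) (u v : 'cV[R]_d).

(** The Schur complement of the corner 1 is [B + t u v^T], so the parameter of the rank-one update
    sits in a single row. *)
Let bordered B u v (t : R) := block_mx B u (- t *: v^T) 1%:M : 'M[R]_(d + 1).

Let det_bordered B u v t :
  \det (bordered B u v t) = \det (B + t *: (u *m v^T)).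
Proof.
have -> : bordered B u v t = block_mx (B + t *: (u *m v^T)) u 0 1%:M *m
    block_mx 1%:M 0 (- t *: v^T) 1%:M.
  rewrite mulmx_block !mulmx1 !mulmx0 !mul1mx !add0r /bordered.
  by rewrite -scalemxAr -addrA -scalerDl subrr scale0r addr0.
by rewrite det_mulmx det_ublock det_lblock !det1 !mulr1.
Qed.

(* The determinant of the bordered matrix is affine in its last row. *)
Lemma det_rank1 B u v t :
  \det (B + t *: (u *m v^T))
  = (1 - t) * \det B + t * \det (B + u *m v^T).
Proof.
have E0 : \det B = \det (bordered B u v 0) by rewrite det_bordered scale0r addr0.
have E1 : \det (B + u *m v^T) = \det (bordered B u v 1).
  by rewrite det_bordered scale1r.
rewrite E0 E1 -det_bordered.
have row'E t' : row' (rshift d 0) (bordered B u v t')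
    = row' (rshift d 0) (bordered B u v t).
  apply/matrixP => i j; rewrite [LHS]mxE [RHS]mxE.
  have : lift (rshift d 0) i != rshift d 0 by rewrite eq_sym neq_lift.
  case: (split_ordP (lift (rshift d 0) i)) => k ->; last by rewrite ord1 eqxx.
  by case: (split_ordP j) => l -> _; rewrite ?block_mxEul ?block_mxEur.
apply: (@determinant_multilinear _ _ _ _ _ (rshift d 0)); rewrite ?row'E //.
rewrite !rowKd !row_id !scale_row_mx add_row_mx; congr row_mx.
  by rewrite !scalerA -scalerDl; congr (_ *: _); ring.
by rewrite -scalerDl subrK scale1r.
Qed.

(** The matrix determinant lemma: once [B] is factored out, the bordered matrix is eliminated from
    its identity block instead of its corner. *)
Lemma det_rank1_unit B u v : B \in unitmx ->
  \det (B + u *m v^T) = \det B * (1 + dotv v (invmx B *m u)).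
Proof.
move=> uB; have -> : B + u *m v^T = B *m (1%:M + (invmx B *m u) *m v^T).
  by rewrite mulmxDr mulmx1 -mulmxA mulKVmx.
rewrite det_mulmx; congr (_ * _); set x := invmx B *m u.
have := det_bordered 1%:M x v 1; rewrite scale1r => <-.
have -> : bordered 1%:M x v 1 = block_mx 1%:M 0 (- v^T) 1%:M *m
    block_mx 1%:M x 0 (1 + dotv v x)%:M.
  rewrite mulmx_block !mulmx1 !mulmx0 !mul1mx !addr0 /bordered.
  congr block_mx; rewrite ?scaleN1r ?mul0mx ?addr0 //.
  rewrite mulNmx [v^T *m x]mx11_scalar -/(dotv v x) -raddfN -raddfD /=.
  by congr (_%:M); ring.
by rewrite det_mulmx det_ublock det_lblock !det1 !mul1r det_mx11 mxE eqxx mulr1n.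
Qed.

End RankOneUpdate.

(** * Bounds on the adjugate and the determinant by the trace and the Frobenius norm *)

Section DeterminantEstimates.
Variables (R : realType) (d : nat) (A : 'M[R]_d).
Hypothesis pdA : posdef A.

Let uA := posdef_unit pdA.
Let detA0 := posdef_det_gt0 pdA.
Let piA := posdef_inv pdA.

(* [\det (A + u u^T) <= exp (tr A + 1 - d)] for unit vectors [u], while the
   matrix determinant lemma gives [u^T adj(A) u <= \det (A + u u^T)]. *)
Lemma adj_quadratic_le u :
  \det A * dotv u (invmx A *m u) <= expR (\tr A - d%:R + 1) * dotv u u.
Proof.
have [->|u0] := eqVneq u 0; first by rewrite mulmx0 /dotv mulmx0 mxE !mulr0.
rewrite -dotv_gt0 in u0; pose s := Num.sqrt (dotv u u)^-1.
have s2 : s * s = (dotv u u)^-1.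
  by rewrite -expr2 sqr_sqrtr // invr_ge0 ltW.
pose v := s *: u.
have v1 : dotv v v = 1.
  by rewrite dotvZl dotvZr mulrA s2 mulVf // gt_eqF.
have := posdef_det_le (posdef_outerD v pdA).
rewrite det_rank1_unit // linearD /= mxtrace_mulC.
have -> : \tr (v^T *m v) = 1.
  by rewrite /mxtrace big_ord_recl big_ord0 addr0 -v1.
have -> : \tr A + 1 - d%:R = \tr A - d%:R + 1 by ring.
move=> h; rewrite -ler_pdivrMr // -mulrA.
have -> : dotv u (invmx A *m u) / dotv u u = dotv v (invmx A *m v).
  by rewrite -scalemxAr dotvZl dotvZr mulrA s2 mulrC.
apply: le_trans h; rewrite mulrDr mulr1 lerDr; exact: ltW.
Qed.

(** Passes from the quadratic form of the adjugate to its norm. For [v = adj(A) u], Cauchy-Schwarz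
    in the form of [A^-1] gives [|v|^4 <= (K |v|^2) (K |u|^2)]. *)
Lemma adj_norm_le u :
  dotv (\det A *: (invmx A *m u)) (\det A *: (invmx A *m u))
  <= expR (\tr A - d%:R + 1) ^+ 2 * dotv u u.
Proof.
set K := expR _; set v := \det A *: _.
have K0 : 0 < K by apply: expR_gt0.
have h := @cauchy_schwarz_mx _ _ (invmx A) v u piA.1 (fun w => posdef_ge0 w piA).
have v1 : dotv v (invmx A *m u) = (\det A)^-1 * dotv v v.
  by rewrite [in RHS]/v dotvZr mulrA mulVf ?gt_eqF // mul1r.
have h1 := adj_quadratic_le v; have h2 := adj_quadratic_le u.
rewrite -/K in h1 h2.
have v0 := dotv_ge0 v; have u0 := dotv_ge0 u.
rewrite v1 in h.
have q1 := posdef_ge0 v piA; have q2 := posdef_ge0 u piA.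
have h3 : dotv v v ^+ 2 <= (K * dotv v v) * (K * dotv u u).
  apply: (@le_trans _ _ ((\det A * dotv v (invmx A *m v)) *
     (\det A * dotv u (invmx A *m u)))).
    have -> : dotv v v ^+ 2 = (\det A) ^+ 2 * ((\det A)^-1 * dotv v v) ^+ 2.
      by field; rewrite gt_eqF.
    have -> : \det A * dotv v (invmx A *m v) * (\det A * dotv u (invmx A *m u))
     = (\det A) ^+ 2 * (dotv v (invmx A *m v) * dotv u (invmx A *m u)) by ring.
    by rewrite ler_wpM2l ?sqr_ge0.
  by apply: ler_pM => //; rewrite mulr_ge0 // ltW.
have [->|vn] := eqVneq (dotv v v) 0; first by rewrite mulr_ge0 ?sqr_ge0.
have vp : 0 < dotv v v by rewrite lt_def vn.
rewrite -(ler_pM2l vp) -expr2 (le_trans h3) // le_eqVlt.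
by apply/orP; left; apply/eqP; ring.
Qed.

(** Since [adj(A) A = \det A], the vector [z] is [- adj(A) (A - 1) g]. *)
Lemma adj_sub_det_norm_le g
    (z := \det A *: (invmx A *m g) - \det A *: g) (e := (A - 1%:M) *m g) :
  dotv z z <= expR (\tr A - d%:R + 1) ^+ 2 * dotv e e.
Proof.
have -> : z = - (\det A *: (invmx A *m e)).
  rewrite /e mulmxBl mul1mx mulmxBr mulKmx // scalerBr opprB.
  by [].
have -> : dotv (- (\det A *: (invmx A *m e))) (- (\det A *: (invmx A *m e)))
   = dotv (\det A *: (invmx A *m e)) (\det A *: (invmx A *m e)).
  by rewrite -scaleN1r dotvZl dotvZr; ring.
exact: adj_norm_le.
Qed.

Let F := \sum_i \sum_j (A - 1%:M) i j ^+ 2.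
Let X := \tr A - d%:R.

Let D_norm_le v :
  dotv ((A - 1%:M) *m v) ((A - 1%:M) *m v) <= F * dotv v v.
Proof.
rewrite dotvE /F mulr_suml; apply: ler_sum => i _; rewrite -expr2 mxE.
have -> : \sum_j (A - 1%:M) i j * v j 0 = dotv (row i (A - 1%:M))^T v.
  by rewrite dotvE; apply: eq_bigr => j _; rewrite !mxE.
apply: le_trans (cauchy_schwarz _ _) _.
rewrite ler_wpM2r ?dotv_ge0 // dotvE; apply: ler_sum => j _.
by rewrite !mxE expr2.
Qed.

Let F0 : 0 <= F.
Proof. by apply: sumr_ge0 => i _; apply: sumr_ge0 => j _; apply: sqr_ge0. Qed.

(* [\det A = 1 / \det A^-1 >= exp (d - tr A^-1)], and
   [A^-1 = 1 - D + A^-1 D^2] with [D = A - 1]. *)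
Lemma det_ge_near1 : F < 4^-1 -> 1 + X - 2 * F <= \det A.
Proof.
move=> F4; pose D := A - 1%:M.
have sD : D^T = D by rewrite /D linearB /= pdA.1 trmx1.
(* [F < 1/4] bounds [|D v|] by [|v| / 2], so the form of [A] is at least half the identity. *)
have half v : 2^-1 * dotv v v <= dotv v (A *m v).
  have AE : A = 1%:M + D by rewrite /D addrC subrK.
  rewrite AE mulmxDl mul1mx dotvDr.
  have h1 := cauchy_schwarz v (D *m v); have h2 := D_norm_le v.
  rewrite -/D in h2; have v0 := dotv_ge0 v.
  have h3 : dotv v (D *m v) ^+ 2 <= (2^-1 * dotv v v) ^+ 2.
    apply: le_trans h1 _; apply: (@le_trans _ _ (dotv v v * (F * dotv v v))).
      by rewrite ler_wpM2l.
    have : 0 <= dotv v v ^+ 2 by apply: sqr_ge0.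
    by nra.
  have : `|dotv v (D *m v)| <= 2^-1 * dotv v v.
    rewrite -(@ler_pXn2r _ 2) ?nnegrE ?mulr_ge0 ?invr_ge0 //.
    by rewrite -normrX ger0_norm ?sqr_ge0.
  by rewrite ler_norml => /andP[h4 _]; lra.
(* With [z = A^-1 u], the bound [half] reads [|z|^2 <= 2 u^T z], whence [(u^T z)^2 <= |u|^2 |z|^2 <=
   2 |u|^2 (u^T z)]. *)
have inv_le u : dotv u (invmx A *m u) <= 2 * dotv u u.
  pose z := invmx A *m u; have := half z; rewrite /z mulKVmx //.
  rewrite (dotvC _ u) -/z => h.
  have h1 := cauchy_schwarz u z; have u0 := dotv_ge0 u.
  have z0 := dotv_ge0 z; have y0 : 0 <= dotv u z by apply: posdef_ge0.
  have [->|yn] := eqVneq (dotv u z) 0; first by rewrite mulr_ge0.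
  have yp : 0 < dotv u z by rewrite lt_def yn.
  rewrite -(ler_pM2l yp) -expr2 (le_trans h1) //; nra.
have trD : \tr (D^T *m (invmx A *m D)) <= 2 * F.
  have -> : F = \sum_j dotv (col j D) (col j D).
    rewrite /F exchange_big; apply: eq_bigr => j _.
    by rewrite dotvE; apply: eq_bigr => i _; rewrite !mxE expr2.
  rewrite mulr_sumr; apply: ler_sum => j _.
  apply: le_trans (inv_le (col j D)); rewrite le_eqVlt; apply/orP; left.
  apply/eqP; rewrite dotvE mxE; apply: eq_bigr => i _; rewrite !mxE.
  by congr (_ * _); apply: eq_bigr => l _; rewrite !mxE.
have iAE : \tr (invmx A) = d%:R - X + \tr (D^T *m (invmx A *m D)).
  rewrite sD mxtrace_mulC -mulmxA {1}/D.
  have -> : (A - 1%:M) *m D = A *m A - 2%:R *: A + 1%:M.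
    rewrite /D mulmxBl !mulmxBr !mul1mx !mulmx1; move: (A *m A) => P.
    by apply/matrixP => i j; rewrite !mxE; ring.
  rewrite mulmxDr mulmxBr mulmx1 mulKmx // -scalemxAr mulVmx //.
  rewrite -scaleNr !mxtraceD mxtraceZ mxtrace1 /X; ring.
have : \det (invmx A) <= expR (- (X - 2 * F)).
  apply: le_trans (posdef_det_le piA) _; rewrite ler_expR iAE; lra.
rewrite det_inv expRN lef_pV2 ?posrE ?expR_gt0 // => h.
by apply: le_trans h; rewrite -addrA expR_ge1Dx.
Qed.

(** The factor 4 covers the case [F >= 1/4], where the right-hand side is at least 1 while [\det A]
    is positive. *)
Lemma det_ge : 1 - \det A <= 4 * F + `|X|.
Proof.
have X0 := ler_norm (- X); rewrite normrN in X0.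
have d0 := ltW detA0; have f0 := F0; have x0 := normr_ge0 X.
have [/det_ge_near1|] := ltP F 4^-1; lra.
Qed.

End DeterminantEstimates.

(** * Moments of the whitened sketch *)

(** Bits are averaged one at a time; [G] is arbitrary so that it absorbs the terms already averaged
    and, later, the perturbation [g h^T]. Separate [u] and [v] let the scaling [k^-1] sit on one
    side. *)
Lemma expect_det_rank1_sum (R : realType) (I : finType) (d : nat) (q : R)
    (u v : I -> 'cV[R]_d) (G : 'M[R]_d) : 0 <= q <= 1 ->
  expect (iid_weight (bernoulli_weight q)) (fun f : {ffun I -> bool} =>
    \det (G + \sum_i (f i)%:R *: (u i *m (v i)^T)))
  = \det (G + q *: \sum_i (u i *m (v i)^T)).
Proof.
move=> q01; have pw := weights_bernoulli q01; rewrite scaler_sumr.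
have := index_enum_uniq I.
elim: (index_enum I) G => [|i s IH] G /=.
  move=> _; under eq_expect do rewrite big_nil.
  by rewrite big_nil (expect_cst (weights_iid pw I)).
move=> /andP[ins us]; rewrite big_cons addrA -IH // (expect_resample pw i).
apply: eq_expect => f; rewrite expect_bernoulli.
have E b : \sum_(j <- i :: s) (resample f i b j)%:R *: (u j *m (v j)^T)
    = b%:R *: (u i *m (v i)^T) + \sum_(j <- s) (f j)%:R *: (u j *m (v j)^T).
  rewrite big_cons ffunE eqxx; congr (_ + _); apply: eq_big_seq => j js.
  by rewrite ffunE; case: eqP => // ji; move: ins; rewrite -ji js.
rewrite !E scale1r scale0r add0r; set S := \sum_(j <- s) _.
rewrite [in RHS]addrAC det_rank1 (addrCA G) [RHS]addrC.
by rewrite [in RHS](addrC (G + S)).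
Qed.

Section Sketch.
Variables (R : realType) (n d : nat).
Variables (B0 : 'M[R]_d) (v : 'I_n -> 'cV[R]_d) (k eps : R).

Definition sketch (f : {ffun 'I_n -> bool}) : 'M[R]_d :=
  B0 + k^-1 *: \sum_i (f i)%:R *: (v i *m (v i)^T).

Definition adj_error (g : 'cV[R]_d) (f : {ffun 'I_n -> bool}) : 'cV[R]_d :=
  \det (sketch f) *: (invmx (sketch f) *m g) - \det (sketch f) *: g.

Definition trace_dev (f : {ffun 'I_n -> bool}) : R := \tr (sketch f) - d%:R.

Definition frob_dev (f : {ffun 'I_n -> bool}) : R :=
  \sum_i \sum_j (sketch f - 1%:M) i j ^+ 2.

Hypothesis d0 : (0 < d)%N.
Hypothesis pB0 : posdef B0.
Hypothesis k0n : 0 < k <= n%:R.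
Hypothesis isotropic : B0 + n%:R^-1 *: \sum_i (v i *m (v i)^T) = 1%:M.
Hypothesis eps0 : 0 < eps.
Hypothesis v_le : forall i, dotv (v i) (v i) <= k * eps.

Let q := k / n%:R.
Let k0 : 0 < k. Proof. by case/andP: k0n. Qed.
Let n0 : 0 < n%:R :> R. Proof. by case/andP: k0n => h; apply: lt_le_trans. Qed.
Let q01 : 0 <= q <= 1.
Proof.
case/andP: k0n => _ kn.
by rewrite divr_ge0 ?(ltW k0) ?(ltW n0) // ler_pdivrMr // mul1r.
Qed.
Let pw := weights_iid (weights_bernoulli q01) 'I_n.
Notation E := (expect (iid_weight (bernoulli_weight q))).

Lemma sketch_posdef f : posdef (sketch f).
Proof.
have [sB pB] := pB0; split.
  rewrite /sketch linearD /= sB linearZ /= raddf_sum /=.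
  by congr (_ + _ *: _); apply: eq_bigr => i _; rewrite linearZ /= trmx_mul trmxK.
move=> u u0; rewrite /sketch mulmxDl dotvDr ltr_pwDl ?pB //.
rewrite -scalemxAl dotvZr mulr_ge0 ?invr_ge0 ?(ltW k0) // mulmx_suml.
rewrite dotv_sumr; apply: sumr_ge0 => i _.
by rewrite -scalemxAl dotvZr dotv_outer (dotvC _ u) -expr2 mulr_ge0 ?sqr_ge0.
Qed.

Lemma sketch_sub1 f :
  sketch f - 1%:M = \sum_i ((f i)%:R - q) *: (k^-1 *: (v i *m (v i)^T)).
Proof.
rewrite -isotropic /sketch opprD addrACA subrr add0r !scaler_sumr -sumrB.
apply: eq_bigr => i _; rewrite !scalerA -scalerBl mulrBl; congr (_ *: _).
by rewrite mulrC /q; field; rewrite !gt_eqF.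
Qed.

Lemma expect_det_sketchD (G : 'M[R]_d) :
  E (fun f => \det (sketch f + G)) = \det (1%:M + G).
Proof.
have := expect_det_rank1_sum (fun i => k^-1 *: v i) v (B0 + G) q01.
rewrite (_ : B0 + G + _ = 1%:M + G); last first.
  rewrite -isotropic addrAC; congr (_ + _ + _).
  rewrite !scaler_sumr; apply: eq_bigr => i _.
  rewrite -scalemxAl scalerA; congr (_ *: _).
  by rewrite /q; field; rewrite !gt_eqF.
move=> <-; apply: eq_expect => f; rewrite addrAC /sketch scaler_sumr.
congr (\det (_ + _ + _)); apply: eq_bigr => i _.
by rewrite -scalemxAl !scalerA mulrC.
Qed.

Lemma expect_adj_error g j : E (fun f => adj_error g f j 0) = 0.
Proof.
pose h : 'cV[R]_d := delta_mx j 0.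
have hE w : dotv h w = w j 0.
  rewrite dotvE (bigD1 j) //= big1 ?mxE ?eqxx ?mul1r ?addr0 // => i ij.
  by rewrite mxE (negbTE ij) mul0r.
have adjE f : adj_error g f j 0
    = \det (sketch f + g *m h^T) + - (1 + g j 0) * \det (sketch f + 0).
  have uS := posdef_unit (sketch_posdef f).
  rewrite det_rank1_unit // hE addr0 /adj_error.
  rewrite mxE [X in X + _]mxE [X in _ + X]mxE [(_ *: g) j 0]mxE; ring.
(* What remains is [\det (1 + g h^T) - (1 + g_j)], which vanishes by the matrix determinant
   lemma. *)
rewrite (eq_expect _ adjE) expectD expectZ !expect_det_sketchD addr0 det1.
rewrite det_rank1_unit ?unitmx1 // det1 invmx1 mul1mx hE; ring.
Qed.

(** Isotropy with the nonnegative form of [B0] dropped. *)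
Let quad_sum_le g : n%:R^-1 * (\sum_i dotv (v i) g ^+ 2) <= dotv g g.
Proof.
have -> : dotv g g
    = dotv g (B0 *m g) + n%:R^-1 * (\sum_i dotv (v i) g ^+ 2).
  rewrite -{2}[g]mul1mx -isotropic mulmxDl dotvDr; congr (_ + _).
  rewrite -scalemxAl dotvZr mulmx_suml dotv_sumr; congr (_ * _).
  by apply: eq_bigr => i _; rewrite dotv_outer (dotvC g) expr2.
by rewrite lerDr posdef_ge0.
Qed.

Let norm_sum_le : n%:R^-1 * (\sum_i dotv (v i) (v i)) <= d%:R.
Proof.
have -> : \sum_i dotv (v i) (v i)
    = \sum_(j < d) \sum_i dotv (v i) (delta_mx j 0) ^+ 2.
  rewrite exchange_big; apply: eq_bigr => i _; rewrite dotvE.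
  apply: eq_bigr => j _; rewrite dotvE (bigD1 j) //= big1 ?addr0; last first.
    by move=> l lj; rewrite mxE (negbTE lj) mulr0.
  by rewrite mxE !eqxx mulr1 expr2.
rewrite mulr_sumr; apply: le_trans (ler_sum _ (fun j _ => quad_sum_le _)) _.
rewrite (eq_bigr (fun=> 1)); first by rewrite sumr_const card_ord.
move=> j _; rewrite dotvE (bigD1 j) //= big1 ?addr0.
  by rewrite mxE !eqxx mulr1.
by move=> l lj; rewrite mxE (negbTE lj) mulr0.
Qed.

Let v2 i : 0 <= dotv (v i) (v i). Proof. exact: dotv_ge0. Qed.

Let d1 : 1 <= d%:R :> R. Proof. by rewrite ler1n. Qed.

Let coord_le (w : 'cV[R]_d) j : `|w j 0| ^+ 2 <= dotv w w.
Proof.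
rewrite -normrX ger0_norm ?sqr_ge0 // dotvE (bigD1 j) //= -expr2 lerDl.
by apply: sumr_ge0 => i _; rewrite -expr2 sqr_ge0.
Qed.

(** One factor [|v_i|^2] is bounded by [k eps]; the other averages to at most [d]. *)
Let v4 : q * (\sum_i (k^-1 * dotv (v i) (v i)) ^+ 2) <= eps * d%:R.
Proof.
apply: (@le_trans _ _ (eps * (n%:R^-1 * (\sum_i dotv (v i) (v i))))).
  rewrite !mulr_sumr; apply: ler_sum => i _.
  have -> : q * (k^-1 * dotv (v i) (v i)) ^+ 2
    = (n%:R^-1 * k^-1 * dotv (v i) (v i)) * dotv (v i) (v i).
    by rewrite /q; field; rewrite !gt_eqF.
  have -> : eps * (n%:R^-1 * dotv (v i) (v i))
    = (n%:R^-1 * k^-1 * dotv (v i) (v i)) * (k * eps).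
    by field; rewrite !gt_eqF.
  by rewrite ler_wpM2l // !mulr_ge0 ?invr_ge0 ?(ltW k0) ?(ltW n0).
by rewrite ler_wpM2l ?(ltW eps0).
Qed.

Let c_le i : `|k^-1 * dotv (v i) (v i)| <= eps.
Proof.
rewrite ger0_norm ?mulr_ge0 ?invr_ge0 ?(ltW k0) //.
by rewrite mulrC ler_pdivrMr // mulrC.
Qed.

Let traceE f :
  trace_dev f = \sum_i ((f i)%:R - q) * (k^-1 * dotv (v i) (v i)).
Proof.
have -> : trace_dev f = \tr (sketch f - 1%:M).
  by rewrite /trace_dev raddfB /= mxtrace1.
rewrite sketch_sub1 raddf_sum /=; apply: eq_bigr => i _.
rewrite !mxtraceZ; congr (_ * (_ * _)); rewrite mxtrace_mulC /mxtrace.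
by rewrite big_ord1.
Qed.

Variable r : nat.
Hypothesis r0 : (0 < r)%N.
Hypothesis small : 32 * (r%:R ^+ 2 * (eps * d%:R)) <= 1.

Let r1 : 1 <= r%:R :> R. Proof. by rewrite ler1n. Qed.
Let ed : eps <= eps * d%:R. Proof. by rewrite ler_peMr // ltW. Qed.
Let red : 32 * (r%:R * (eps * d%:R)) <= 1.
Proof.
apply: le_trans small; rewrite ler_wpM2l // ler_wpM2r ?mulr_ge0 ?(ltW eps0) //.
by rewrite expr2 ler_peMr.
Qed.

(** The exponent [4 r] is what the AM-GM splitting in [adj_error_moment] produces. Its variance term
    [2 (4 r)^2 eps d] is the origin of the 32 in [small]. *)
Lemma trace_dev_mgf : E (fun f => expR ((4 * r%:R) * trace_dev f)) <= 4.
Proof.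
under eq_expect => f.
  rewrite traceE mulr_sumr.
  under eq_bigr => i _ do rewrite mulrCA.
  over.
apply: le_trans (bernoulli_sum_mgf q01 _) _ => [i|].
  rewrite normrM (ger0_norm (_ : 0 <= 4 * r%:R)) ?mulr_ge0 //.
  apply: (@le_trans _ _ (4 * r%:R * eps)); first by rewrite ler_wpM2l ?mulr_ge0.
  have := red; have := ed; have := r1; have := eps0.
  move: (r%:R : R) (d%:R : R) => rr dd *; nra.
apply: le_trans (expR1_le4 R); rewrite ler_expR.
under eq_bigr do rewrite exprMn.
rewrite -mulr_sumr.
apply: (@le_trans _ _ (2 * ((4 * r%:R) ^+ 2 * (eps * d%:R)))).
  by rewrite ler_wpM2l // mulrCA ler_wpM2l ?sqr_ge0.
by apply: le_trans small; rewrite le_eqVlt; apply/orP; left; apply/eqP; ring.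
Qed.

Lemma trace_dev_moment :
  E (fun f => trace_dev f ^+ (2 * r)%N) <= (32 * (r%:R * (eps * d%:R))) ^+ r.
Proof.
under eq_expect => f do rewrite traceE.
apply: le_trans (@bernoulli_sum_moment _ _ _ q01 _ eps (2 * (eps * d%:R))
   _ r0 _ c_le _) _.
- by rewrite !mulr_gt0 // (lt_le_trans _ d1).
- rewrite (_ : 2 = 1 + 1) // mulrDl !mul1r lerD //.
  have := red; have := ed; have := r1; have := eps0; have := d1.
  move: (r%:R : R) (d%:R : R) => rr dd *.
  rewrite expr2 mulrA -[leRHS]mul1r.
  by apply: ler_pM => //; nra.
by rewrite le_eqVlt; apply/orP; left; apply/eqP; congr (_ ^+ _); ring.
Qed.

Let j0 : 'I_d := Ordinal d0.

(** The entries of [A - 1] form a Bernoulli vector with [d^2] coordinates of size [eps] and total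
    variance [eps d]. With [y = r eps d] the vector bound reads [32 y + 64 y^2], and [32 y <= 1]
    turns it into [64 y]. *)
Lemma frob_dev_moment :
  E (fun f => frob_dev f ^+ (2 * r)%N)
  <= (64 * (r%:R * (eps * d%:R))) ^+ (2 * r)%N.
Proof.
pose u i (jl : 'I_d * 'I_d) := k^-1 * (v i jl.1 0 * v i jl.2 0).
have FE f : frob_dev f = \sum_jl (\sum_i ((f i)%:R - q) * u i jl) ^+ 2.
  rewrite /frob_dev pair_big; apply: eq_bigr => -[j l] _ /=.
  congr (_ ^+ _); rewrite sketch_sub1 summxE; apply: eq_bigr => i _.
  by rewrite !mxE big_ord1 !mxE.
under eq_expect => f do rewrite FE.
apply: le_trans (@bernoulli_vector_moment _ _ _ q01 _ (j0, j0) u eps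
  (eps * d%:R) (2 * r)%N _ eps0 _ _) _.
- by rewrite muln_gt0.
- move=> i [j l]; rewrite /u /=; apply: le_trans (c_le i).
  rewrite !normrM ler_wpM2l // (ger0_norm (v2 i)).
  have := coord_le (v i) j; have := coord_le (v i) l.
  have := sqr_ge0 (`|v i j 0| - `|v i l 0|).
  move: (`|_|) (`|_|) => a b *; nra.
- apply: le_trans v4; case/andP: q01 => q0 _; rewrite ler_wpM2l //.
  apply: ler_sum => i _; rewrite le_eqVlt; apply/orP; left; apply/eqP.
  rewrite exprMn dotvE [X in _ = _ * X]expr2 big_distrlr /= pair_big mulr_sumr.
  by apply: eq_bigr => -[j l] _ /=; rewrite /u /=; ring.
rewrite card_prod card_ord lerXn2r ?nnegrE //.
- have e0 := ltW eps0.
  by rewrite !(mulr_ge0, addr_ge0) // sqr_ge0.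
- by have e0 := ltW eps0; rewrite !mulr_ge0.
have := red; have := ed; have := r1; have := eps0; have := d1.
rewrite !natrM; move: (r%:R : R) (d%:R : R) => rr dd *.
have -> : 16 * (2 * rr) * (eps * dd + dd * dd * (2 * rr * eps ^+ 2))
  = 32 * (rr * (eps * dd)) + 64 * (rr * (eps * dd)) ^+ 2 by ring.
have h : 0 <= rr * (eps * dd) by rewrite !mulr_ge0; lra.
nra.
Qed.

(** Treating [(A - 1) g] as a vector with [d] coordinates gives total variance [eps |g|^2]; going
    through the Frobenius norm of [A - 1] would cost a further factor [d]. *)
Lemma residual_moment g (e := fun f => (sketch f - 1%:M) *m g) : g != 0 ->
  E (fun f => dotv (e f) (e f) ^+ (2 * r)%N)
  <= (64 * (r%:R * (eps * dotv g g))) ^+ (2 * r)%N.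
Proof.
move=> g0; have gg : 0 < dotv g g by rewrite dotv_gt0.
pose u i (j : 'I_d) := k^-1 * (dotv (v i) g * v i j 0).
have eE f : dotv (e f) (e f) = \sum_j (\sum_i ((f i)%:R - q) * u i j) ^+ 2.
  rewrite dotvE; apply: eq_bigr => j _; rewrite -expr2; congr (_ ^+ _).
  rewrite /e sketch_sub1 mulmx_suml summxE; apply: eq_bigr => i _.
  rewrite -!scalemxAl -mulmxA [(v i)^T *m g]mx11_scalar mul_mx_scalar.
  by rewrite /u /dotv !mxE.
under eq_expect => f do rewrite eE.
pose G := Num.sqrt (dotv g g).
have G0 : 0 < G by rewrite sqrtr_gt0.
have G2 : G ^+ 2 = dotv g g by rewrite sqr_sqrtr // ltW.
apply: le_trans (@bernoulli_vector_moment _ _ _ q01 _ j0 u (eps * G)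
  (eps * dotv g g) (2 * r)%N _ _ _ _) _.
- by rewrite muln_gt0.
- by rewrite mulr_gt0.
- move=> i j; rewrite -(@ler_pXn2r _ 2) ?nnegrE ?mulr_ge0 ?(ltW eps0) ?(ltW G0) //.
  rewrite [leRHS]exprMn G2 /u !normrM !exprMn.
  have h1 := cauchy_schwarz (v i) g; have h2 := coord_le (v i) j.
  apply: (@le_trans _ _ (`|k^-1| ^+ 2 * ((dotv (v i) (v i) * dotv g g) *
     dotv (v i) (v i)))).
    rewrite ler_wpM2l ?exprn_ge0 // ler_pM ?exprn_ge0 //.
    by rewrite -normrX ger0_norm ?sqr_ge0.
  rewrite -normrX ger0_norm ?sqr_ge0 //.
  have := c_le i; rewrite ger0_norm ?mulr_ge0 ?invr_ge0 ?(ltW k0) // => h3.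
  have -> : k^-1 ^+ 2 * (dotv (v i) (v i) * dotv g g * dotv (v i) (v i))
    = (k^-1 * dotv (v i) (v i)) ^+ 2 * dotv g g by ring.
  rewrite ler_wpM2r ?(ltW gg) // lerXn2r ?nnegrE ?(ltW eps0) //.
  by rewrite mulr_ge0 ?invr_ge0 ?(ltW k0).
- apply: (@le_trans _ _ (eps * (n%:R^-1 * (\sum_i dotv (v i) g ^+ 2)))); last first.
    by rewrite ler_wpM2l ?(ltW eps0).
  rewrite !mulr_sumr; apply: ler_sum => i _.
  have -> : \sum_j u i j ^+ 2 = k^-1 ^+ 2 * (dotv (v i) g ^+ 2 * dotv (v i) (v i)).
    rewrite [X in _ = _ * (_ * X)]dotvE !mulr_sumr.
    by apply: eq_bigr => j _; rewrite /u; ring.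
  have -> : q * (k^-1 ^+ 2 * (dotv (v i) g ^+ 2 * dotv (v i) (v i)))
    = (k^-1 * dotv (v i) (v i)) * (n%:R^-1 * dotv (v i) g ^+ 2).
    by rewrite /q; field; rewrite !gt_eqF.
  have h : 0 <= n%:R^-1 * dotv (v i) g ^+ 2.
    by rewrite mulr_ge0 ?invr_ge0 ?sqr_ge0.
  rewrite ler_wpM2r //.
  by apply: le_trans (c_le i); apply: ler_norm.
rewrite card_ord lerXn2r ?nnegrE //.
- have e0 := ltW eps0; have g1 := ltW gg; have G1 := ltW G0.
  by rewrite !(mulr_ge0, addr_ge0).
- by have e0 := ltW eps0; rewrite !mulr_ge0 // ltW.
have := red; have := ed; have := r1; have := eps0; have := d1.
rewrite exprMn G2 !natrM; move: (r%:R : R) (d%:R : R) => rr dd *.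
have -> : 16 * (2 * rr) *
    (eps * dotv g g + dd * (2 * rr * (eps ^+ 2 * dotv g g)))
  = 32 * (rr * (eps * dotv g g))
    + 64 * (rr * (eps * dd)) * (rr * (eps * dotv g g)) by ring.
have h : 0 <= rr * (eps * dotv g g) by rewrite !mulr_ge0; lra.
nra.
Qed.

(* AM-GM splits [exp (2 r X) |e|^(2r)], with [theta] the size of [|e|^2] found
   in [residual_moment]. *)
Lemma adj_error_moment g j : g != 0 ->
  E (fun f => adj_error g f j 0 ^+ (2 * r)%N)
  <= (2 ^+ 12 * (r%:R * (eps * dotv g g))) ^+ r.
Proof.
move=> g0; have gg : 0 < dotv g g by rewrite dotv_gt0.
pose theta := 64 * (r%:R * (eps * dotv g g)).
have theta0 : 0 < theta by rewrite !mulr_gt0 // ltr0n.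
pose e f := (sketch f - 1%:M) *m g.
have young (a W : R) :
    a * W <= 2^-1 * (theta ^+ r * a ^+ 2 + theta ^- r * W ^+ 2).
  have t0 : 0 < theta ^+ r by rewrite exprn_gt0.
  rewrite -subr_ge0.
  have -> : 2^-1 * (theta ^+ r * a ^+ 2 + theta ^- r * W ^+ 2) - a * W
    = 2^-1 * (theta ^- r * (theta ^+ r * a - W) ^+ 2).
    by field; rewrite gt_eqF.
  by rewrite mulr_ge0 // mulr_ge0 ?sqr_ge0 // invr_ge0 ltW.
apply: (@le_trans _ _ (E (fun f => 16 ^+ r * (2^-1 *
    (theta ^+ r * expR (4 * r%:R * trace_dev f)
     + theta ^- r * dotv (e f) (e f) ^+ (2 * r)))))).
  apply: (expect_le pw) => f.
  have h := adj_sub_det_norm_le (sketch_posdef f) g.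
  rewrite -/(adj_error g f) -/(e f) -/(trace_dev f) in h.
  have hj := coord_le (adj_error g f) j.
  rewrite -normrX ger0_norm ?sqr_ge0 // in hj.
  have {h}hj := le_trans hj h.
  rewrite exprM; apply: (@le_trans _ _
    ((expR (trace_dev f + 1) ^+ 2 * dotv (e f) (e f)) ^+ r)).
    by rewrite lerXn2r ?nnegrE ?sqr_ge0 // mulr_ge0 ?sqr_ge0 ?dotv_ge0.
  have -> : (expR (trace_dev f + 1) ^+ 2 * dotv (e f) (e f)) ^+ r
    = expR 1 ^+ (2 * r) * (expR (2 * r%:R * trace_dev f) * dotv (e f) (e f) ^+ r).
    rewrite exprMn -exprM -natrM expRM_natl expRD exprMn; ring.
  apply: ler_pM.
  - by rewrite exprn_ge0 // expR_ge0.
  - by rewrite mulr_ge0 ?expR_ge0 // exprn_ge0 // dotv_ge0.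
  - have -> : 16 = 4 ^+ 2 :> R by rewrite -natrX.
    by rewrite -exprM lerXn2r ?nnegrE ?expR_ge0 // expR1_le4.
  apply: le_trans (young _ _) _; rewrite ler_wpM2l // le_eqVlt.
  apply/orP; left; apply/eqP; congr (_ * _ + _ * _); last first.
    by rewrite -exprM mulnC.
  by rewrite -expRM_natl; congr expR; ring.
rewrite expectZ expectZ expectD !expectZ.
have h1 := trace_dev_mgf; have h2 := residual_moment g0.
rewrite -/theta in h2.
(* 16 bounds [e^2], [4^r] absorbs the half-sum [(4 + 1) / 2], and [theta] carries 64; together they
   make [2^12]. *)
apply: (@le_trans _ _ (16 ^+ r * (4 ^+ r * theta ^+ r))).
  rewrite ler_wpM2l ?exprn_ge0 //.
  have t0 : 0 < theta ^+ r by rewrite exprn_gt0.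
  have h3 : theta ^- r * E (fun f => dotv (e f) (e f) ^+ (2 * r)%N) <= theta ^+ r.
    by rewrite mulrC ler_pdivrMr // -expr2 -exprM (mulnC r 2).
  have h4 : theta ^+ r * E (fun f => expR (4 * r%:R * trace_dev f)) <= theta ^+ r * 4.
    by rewrite ler_wpM2l // ltW.
  have h5 : 4 <= 4 ^+ r :> R by rewrite -[leLHS]expr1 ler_weXn2l // ler1n.
  move: h3 h4 h5 t0; move: (theta ^- r * _) (theta ^+ r * _) => a b.
  move: (theta ^+ r) (4 ^+ r) => c c4; nra.
by rewrite -!exprMn le_eqVlt; apply/orP; left; apply/eqP; congr (_ ^+ _);
  rewrite /theta; ring.
Qed.

(** [frob_dev] is already quadratic, so its moment has order [y^(2r)] for [y = r eps d]; [32 y <= 1]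
    reduces this to [(2^11 y)^r]. Splitting the sum contributes [2^(2r)] and adding the two bounds
    at most [2^r]. *)
Lemma det_deficit_moment :
  E (fun f => (4 * frob_dev f + `|trace_dev f|) ^+ (2 * r)%N)
  <= (2 ^+ 14 * (r%:R * (eps * d%:R))) ^+ r.
Proof.
have F0 f : 0 <= frob_dev f.
  by apply: sumr_ge0 => i _; apply: sumr_ge0 => j _; apply: sqr_ge0.
have split_pow (a b : R) N : 0 <= a -> 0 <= b ->
    (a + b) ^+ N <= 2 ^+ N * (a ^+ N + b ^+ N).
  move=> a0 b0; wlog ab : a b a0 b0 / a <= b => [hw|].
    case/orP: (le_total a b) => ab; first exact: hw.
    by rewrite addrC [X in _ * X]addrC; apply: hw.
  rewrite mulrDr -[leLHS]add0r lerD ?mulr_ge0 ?exprn_ge0 //.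
  rewrite -exprMn lerXn2r ?nnegrE ?addr_ge0 ?mulr_ge0 //.
  by rewrite mulrDl mul1r lerD2r.
apply: (@le_trans _ _ (E (fun f => 2 ^+ (2 * r) * (4 ^+ (2 * r) *
    frob_dev f ^+ (2 * r) + trace_dev f ^+ (2 * r))))).
  apply: (expect_le pw) => f.
  apply: le_trans (split_pow _ _ _ _ _) _ => //; first by rewrite mulr_ge0.
  by rewrite exprMn [`|_| ^+ _]exprM -normrX ger0_norm ?sqr_ge0 // -exprM.
rewrite expectZ expectD expectZ.
set y := r%:R * (eps * d%:R).
have y0 : 0 <= y by rewrite !mulr_ge0 // ltW.
have h1 := frob_dev_moment; have h2 := trace_dev_moment.
rewrite -/y in h1 h2.
apply: (@le_trans _ _ (2 ^+ (2 * r) *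
   (4 ^+ (2 * r) * (64 * y) ^+ (2 * r) + (32 * y) ^+ r))).
  by rewrite ler_wpM2l ?exprn_ge0 // lerD // ler_wpM2l ?exprn_ge0.
have y1 := red; rewrite -/y in y1.
have y2 : 0 <= 2 ^+ 11 * y by rewrite mulr_ge0 // exprn_ge0.
have h3 : 4 ^+ (2 * r) * (64 * y) ^+ (2 * r) <= (2 ^+ 11 * y) ^+ r.
  have h : (4 * (64 * y)) ^+ 2 <= 2 ^+ 11 * y.
    rewrite -subr_ge0.
    have -> : 2 ^+ 11 * y - (4 * (64 * y)) ^+ 2 = 2 ^+ 11 * (y * (1 - 32 * y)).
      by ring.
    by rewrite mulr_ge0 ?exprn_ge0 // mulr_ge0 // subr_ge0.
  by rewrite -exprMn exprM lerXn2r // nnegrE sqr_ge0.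
have h4 : (32 * y) ^+ r <= (2 ^+ 11 * y) ^+ r.
  have -> : 32 = 2 ^+ 5 :> R by ring.
  rewrite lerXn2r ?nnegrE //; first by rewrite mulr_ge0 // exprn_ge0.
  by rewrite ler_wpM2r // ler_weXn2l // ler1n.
apply: (@le_trans _ _ (2 ^+ (2 * r) * (2 ^+ r * (2 ^+ 11 * y) ^+ r))).
  rewrite ler_wpM2l ?exprn_ge0 //.
  have h5 : 2 <= 2 ^+ r :> R by rewrite -[leLHS]expr1 ler_weXn2l // ler1n.
  have h6 : 0 <= (2 ^+ 11 * y) ^+ r by rewrite exprn_ge0.
  apply: le_trans (lerD h3 h4) _.
  by apply: le_trans (ler_wpM2r h6 h5); rewrite [leRHS]mulr_natl mulr2n.
rewrite exprM -!exprMn le_eqVlt; apply/orP; left; apply/eqP; congr (_ ^+ _).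
by rewrite /y; ring.
Qed.

(** * Tail bounds for sums over [m] independent sketches *)

Variable m : nat.
Hypothesis m0 : (0 < m)%N.

(** Markov at order [r] for the squared norm; Jensen over the coordinates reduces it to scalar sums
    at the cost of [d^r]. The constant is [2^12] from [adj_error_moment], times 4 from [(2r)^2] and
    4 from [(eta / 2)^2]. *)
Lemma adj_error_tail (g : 'cV[R]_d) (eta : R) : g != 0 -> 0 < eta ->
  \sum_(ff : {ffun 'I_m -> {ffun 'I_n -> bool}} |
      (eta / 2) ^+ 2 * (m%:R * dotv g g)
      < dotv (\sum_t adj_error g (ff t)) (\sum_t adj_error g (ff t)))
    iid_weight (iid_weight (bernoulli_weight q)) ff
  <= 16 * (2 ^+ 16 * (r%:R ^+ 3 * (eps * d%:R)) / eta ^+ 2) ^+ r.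
Proof.
move=> g0 eta0; have gg : 0 < dotv g g by rewrite dotv_gt0.
have pww := weights_iid pw 'I_m.
have m0' : 0 < m%:R :> R by rewrite ltr0n.
have r0' : 0 < r%:R :> R by rewrite ltr0n.
have d0' : 0 < d%:R :> R by rewrite ltr0n.
pose S (ff : {ffun 'I_m -> {ffun 'I_n -> bool}}) := \sum_t adj_error g (ff t).
pose c := (eta / 2) ^+ 2 * (m%:R * dotv g g).
have c0 : 0 < c by rewrite !(mulr_gt0, exprn_gt0) // invr_gt0.
have := @expect_markov _ _ _ pww (fun ff => dotv (S ff) (S ff) ^+ r) (c ^+ r)
  (fun ff => c < dotv (S ff) (S ff)).
move=> /(_ (fun ff => exprn_ge0 r (dotv_ge0 (S ff)))) /=.
have h ff : c < dotv (S ff) (S ff) -> c ^+ r <= dotv (S ff) (S ff) ^+ r.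
  by move=> /ltW h; rewrite lerXn2r ?nnegrE ?dotv_ge0 // ltW.
move=> /(_ h) {h} => markov.
have cr0 : 0 < c ^+ r by rewrite exprn_gt0.
rewrite -(ler_pM2l cr0); apply: le_trans markov _.
pose u (j : 'I_d) : R := d%:R^-1.
have uw : weights u.
  split=> [j|]; first by rewrite invr_ge0.
  by rewrite sumr_const card_ord -[LHS]mulr_natr mulVf // gt_eqF.
have SE ff : dotv (S ff) (S ff)
    = d%:R * expect u (fun j => (\sum_t adj_error g (ff t) j 0) ^+ 2).
  rewrite dotvE /expect mulr_sumr; apply: eq_bigr => j _.
  by rewrite mulrA /u divff ?gt_eqF // mul1r summxE expr2.
apply: (@le_trans _ _ (expect (iid_weight (iid_weight (bernoulli_weight q)))
   (fun ff => d%:R ^+ r * expect u (fun j =>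
       (\sum_t adj_error g (ff t) j 0) ^+ (2 * r))))).
  apply: (expect_le pww) => ff; rewrite SE exprMn ler_wpM2l ?exprn_ge0 //.
  under [leRHS]eq_expect do rewrite exprM.
  by apply: expect_pow_le => // j; rewrite sqr_ge0.
rewrite expectZ.
set tau := 2 ^+ 12 * (r%:R * (eps * dotv g g)).
have tau0 : 0 < tau by rewrite !mulr_gt0.
apply: (@le_trans _ _ (d%:R ^+ r * (16 * ((2 * r)%:R ^+ 2 * (m%:R * tau)) ^+ r))).
  rewrite ler_wpM2l ?exprn_ge0 // /expect.
  under eq_bigr do rewrite mulr_sumr.
  rewrite exchange_big /= -[leRHS](expect_cst uw); apply: ler_sum => j _.
  rewrite (_ : \sum__ _ = u j * expect (iid_weight (iid_weight (bernoulli_weight q)))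
     (fun ff : {ffun 'I_m -> _} => (\sum_t adj_error g (ff t) j 0) ^+ (2 * r))).
    rewrite ler_wpM2l ?uw.1 //.
    apply: (@iid_sum_moment R _ (iid_weight (bernoulli_weight q))
       (fun f => adj_error g f j 0)) => //.
      exact: expect_adj_error.
    exact: adj_error_moment.
  rewrite /expect mulr_sumr; apply: eq_bigr => f _; ring.
rewrite mulrCA [leRHS]mulrCA -!exprMn le_eqVlt; apply/orP; left; apply/eqP.
congr (_ * _ ^+ _); rewrite /tau /c natrM; field.
by rewrite gt_eqF.
Qed.

(** If the mean determinant is below 1/2, the mean deficit exceeds 1/2. Jensen moves the power
    inside the average over [t], leaving the moment of a single copy. *)
Lemma det_sum_tail :
  \sum_(ff : {ffun 'I_m -> {ffun 'I_n -> bool}} |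
      \sum_t \det (sketch (ff t)) < m%:R / 2)
    iid_weight (iid_weight (bernoulli_weight q)) ff
  <= (2 ^+ 16 * (r%:R * (eps * d%:R))) ^+ r.
Proof.
have pww := weights_iid pw 'I_m.
have m0' : 0 < m%:R :> R by rewrite ltr0n.
pose Y f := 4 * frob_dev f + `|trace_dev f|.
have Y0 f : 0 <= Y f.
  rewrite addr_ge0 // mulr_ge0 //.
  by apply: sumr_ge0 => i _; apply: sumr_ge0 => j _; apply: sqr_ge0.
pose u (t : 'I_m) : R := m%:R^-1.
have uw : weights u.
  split=> [j|]; first by rewrite invr_ge0.
  by rewrite sumr_const card_ord -[LHS]mulr_natr mulVf // gt_eqF.
pose h (ff : {ffun 'I_m -> {ffun 'I_n -> bool}}) :=
  expect u (fun t => Y (ff t)) ^+ (2 * r).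
have h0 ff : 0 <= h ff by rewrite exprn_ge0 // expect_ge0.
have := @expect_markov _ _ _ pww h (2^-1 ^+ (2 * r))
  (fun ff : {ffun 'I_m -> {ffun 'I_n -> bool}} =>
     \sum_t \det (sketch (ff t)) < m%:R / 2) h0.
have hc (ff : {ffun 'I_m -> {ffun 'I_n -> bool}}) :
    \sum_t \det (sketch (ff t)) < m%:R / 2 -> 2^-1 ^+ (2 * r) <= h ff.
  move=> hd; rewrite lerXn2r ?nnegrE ?expect_ge0 // /expect -mulr_sumr mulrC.
  rewrite ler_pdivlMr // mulrC.
  have : \sum_t (1 - \det (sketch (ff t))) <= \sum_t Y (ff t).
    by apply: ler_sum => t _; apply: det_ge; apply: sketch_posdef.
  rewrite sumrB sumr_const card_ord; lra.
move=> /(_ hc) markov.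
have c0 : 0 < 2^-1 ^+ (2 * r) :> R by rewrite exprn_gt0 // invr_gt0.
rewrite -(ler_pM2l c0); apply: le_trans markov _.
apply: (@le_trans _ _ ((2 ^+ 14 * (r%:R * (eps * d%:R))) ^+ r)).
  apply: (@le_trans _ _ (expect (iid_weight (iid_weight (bernoulli_weight q)))
   (fun ff => expect u (fun t => Y (ff t) ^+ (2 * r))))).
    by apply: (expect_le pww) => ff; apply: expect_pow_le.
  rewrite /expect; under eq_bigr do rewrite mulr_sumr.
  rewrite exchange_big /= -[leRHS](expect_cst uw); apply: ler_sum => t _.
  rewrite (_ : \sum__ _ = u t * expect (iid_weight (iid_weight (bernoulli_weight q)))
     (fun ff : {ffun 'I_m -> _} => Y (ff t) ^+ (2 * r))).
    rewrite ler_wpM2l ?uw.1 //.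
    rewrite (expect_iid_marginal pw t (fun f => Y f ^+ (2 * r))).
    exact: det_deficit_moment.
  rewrite /expect mulr_sumr; apply: eq_bigr => f _; ring.
rewrite exprM -exprMn le_eqVlt; apply/orP; left; apply/eqP; congr (_ ^+ _).
by field.
Qed.

End Sketch.

(** * Convexity and Hessians of ridge functions *)

Section Derivatives.
Variable R : realType.

Lemma is_derive_affine (l : R -> R) (a s dl : R) :
  is_derive s 1 l dl -> is_derive (0 : R) 1 (fun h => l (h * a + s)) (dl * a).
Proof.
move=> dl'.
have E : (fun h : R => h * a + s) = (a \*: (id : R -> R^o)) + cst s.
  by apply/funext => h /=; rewrite [LHS]addrC [RHS]addrC mulrC.
apply: (@is_derive1_comp _ l (fun h => h * a + s)).
  by rewrite mul0r add0r.
rewrite E; apply: is_derive_eq.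
by rewrite addr0 /GRing.scale /= mulr1.
Qed.

Lemma convex_tangent (f : R -> R) (x y : R) : convex_on_line f ->
  derivable f x 1 -> f x + derive1 f x * (y - x) <= f y.
Proof.
move=> cf df.
have seg (t : R) : 0 < t -> t <= 1 ->
    f (t * (y - x) + x) <= t * f y + (1 - t) * f x.
  move=> t0 t1; have t01 : Itv.spec (@Itv.num_sem R)
      (Itv.Real `[Posz 0, Posz 1]) t.
    by rewrite /Itv.spec /= /Itv.num_sem /= num_real /= in_itv /= (ltW t0) t1.
  have := cf (Itv.mk t01) y x; rewrite !in_setT => /(_ isT isT).
  rewrite /conv /=.
  suff -> : t *: (y : R^o) + (1 - t) *: (x : R^o) = t * (y - x) + x by [].
  by rewrite /GRing.scale /=; ring.
pose p := fun h : R => f (h * (y - x) + x).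
have dp : is_derive (0 : R) 1 p (derive1 f x * (y - x)).
  by apply: is_derive_affine; rewrite derive1E; apply: derivableP.
case: dp => cp <-; rewrite -lerBrDl.
(* Convexity controls the difference quotient only for [0 < h <= 1], hence the one-sided limit. *)
have /cvg_dnbhs_at_right cr : (h^-1 *: ((p \o shift 0) (h *: 1) - p 0)) @[h --> 0^']
    --> 'D_1 p 0 by exact: cp.
apply: (cvgr_to_le cr).
near=> h.
have h0 : 0 < h by near: h; apply: nbhs_right_gt.
have h1 : h <= 1 by near: h; apply: nbhs_right_le.
rewrite /= addr0 [h%:A]mulr1 /p mul0r add0r [_ *: _]mulrC ler_pdivrMr //.
have := seg h h0 h1; lra.
Unshelve. all: by end_near. Qed.

(** Adding the tangent inequalities at two points shows that [f'] is nondecreasing, so its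
    difference quotients are nonnegative. *)
Lemma convex_derive2_ge0 (f : R -> R) (x : R) : convex_on_line f ->
  twice_differentiable f -> 0 <= derive1n 2 f x.
Proof.
move=> cf [df d2f]; rewrite derive1nS derive1n1.
have mono a b : a < b -> derive1 f a <= derive1 f b.
  move=> ab.
  have h1 := convex_tangent b cf (df a); have h2 := convex_tangent a cf (df b).
  nra.
rewrite derive1E; apply: limr_ge; first exact: d2f.
apply: nearW => h /=; rewrite [h%:A]mulr1.
have [h0|h0|->] := ltgtP h 0; last by rewrite invr0 scale0r.
  rewrite [_ *: _]/(_ * _) mulr_le0 ?invr_le0 ?(ltW h0) // subr_le0 mono //.
  by rewrite gtrDr.
rewrite [_ *: _]/(_ * _) mulr_ge0 ?invr_ge0 ?(ltW h0) // subr_ge0 mono //.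
by rewrite ltrDr.
Qed.

(** A directional derivative depends only on the restriction to a line, where the one-variable rules
    apply. *)
Lemma derive_line d (f : 'cV[R]_d -> R) (w e : 'cV[R]_d) (df : R) :
  is_derive (0 : R) 1 (fun h : R => f (h *: e + w)) df -> is_derive w e f df.
Proof.
move=> [h1 h2]; split; first by apply/derivable1P.
rewrite -h2 /derive.
set g1 := fun h => h^-1 *: _; set g2 := fun h => h^-1 *: _.
suff -> : g1 = g2 by [].
by apply/funext => h; rewrite /g1 /g2 /= addr0 scale0r add0r [_%:A]mulr1.
Qed.

Lemma is_derive_ridge (n d : nat) (x : 'I_n -> 'cV[R]_d) (l : 'I_n -> R -> R)
    (c : 'I_n -> R) (w e : 'cV[R]_d) :
  (forall i u, derivable (l i) u 1) ->
  is_derive w e (fun u => \sum_i c i * l i (dotv u (x i)))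
    (\sum_i c i * (derive1 (l i) (dotv w (x i)) * dotv e (x i))).
Proof.
move=> dl; apply: derive_line.
have -> : (fun h : R => \sum_i c i * l i (dotv (h *: e + w) (x i)))
  = \sum_i (c i \*: ((fun h => l i (h * dotv e (x i) + dotv w (x i))) : R -> R^o)).
  apply/funext => h; rewrite fct_sumE; apply: eq_bigr => i _ /=.
  by rewrite dotvDl dotvZl.
apply: is_derive_sum => i; apply: is_deriveZ; apply: is_derive_affine.
by rewrite derive1E; apply: derivableP.
Qed.

Lemma is_derive_dotvl d (c : R) (v w e : 'cV[R]_d) :
  is_derive w e (fun u => c * dotv u v) (c * dotv e v).
Proof.
apply: derive_line.
have -> : (fun h : R => c * dotv (h *: e + w) v)
    = ((c * dotv e v) \*: (id : R -> R^o)) + cst (c * dotv w v).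
  apply/funext => h; rewrite -[RHS]/(_ + _) /= dotvDl dotvZl /GRing.scale /=.
  ring.
by apply: is_derive_eq; rewrite addr0 /GRing.scale /= mulr1.
Qed.

Lemma is_derive_sqnorm d (lambda : R) (w e : 'cV[R]_d) :
  is_derive w e (fun u => lambda / 2 * dotv u u) (lambda * dotv w e).
Proof.
apply: derive_line.
have d1 : is_derive (0 : R) 1 (id : R -> R) 1 by apply: is_derive_id.
have D := is_deriveD (is_deriveD
  (is_deriveZ (lambda / 2 * dotv e e) (is_deriveM d1 d1))
  (is_deriveZ (lambda * dotv w e) d1))
  (is_derive_cst (lambda / 2 * dotv w w) (0 : R) 1).
set F := (X in is_derive _ _ X _) in D.
have -> : (fun h : R => lambda / 2 * dotv (h *: e + w) (h *: e + w)) = F.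
  apply/funext => h; rewrite /F -[RHS]/(_ + _ + _) /=.
  rewrite !(dotvDl, dotvDr, dotvZl, dotvZr) (dotvC e w) /GRing.scale /=.
  by rewrite -[(_ * _) h]/(h * h); field.
case: D => D1 D2; split; first exact: D1.
rewrite D2 addr0 /GRing.scale /=; ring.
Qed.

(** The free coefficients [c] serve both the full loss ([1 / n]) and the subsampled one
    ([b_i / k]). *)
Lemma hessian_ridge (n d : nat) (x : 'I_n -> 'cV[R]_d) (l : 'I_n -> R -> R)
    (c : 'I_n -> R) (lambda : R) (w : 'cV[R]_d) :
  (forall i, twice_differentiable (l i)) ->
  hessian (fun u => \sum_i c i * l i (dotv u (x i)) + lambda / 2 * dotv u u) w
  = lambda%:M + \sum_i (c i * derive1n 2 (l i) (dotv w (x i)))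
                *: (x i *m (x i)^T).
Proof.
move=> dl; apply/matrixP => i j; rewrite !mxE.
have dotd (v : 'cV[R]_d) a : dotv (delta_mx a 0) v = v a 0.
  rewrite dotvE (bigD1 a) //= big1 ?addr0 => [|b ba].
    by rewrite mxE !eqxx mul1r.
  by rewrite mxE (negbTE ba) mul0r.
have -> : (fun v => 'D_(delta_mx i 0)
    (fun u => \sum_i c i * l i (dotv u (x i)) + lambda / 2 * dotv u u) v)
  = (fun v => \sum_s (c s * x s i 0) * derive1 (l s) (dotv v (x s)))
    + (fun v => lambda * dotv v (delta_mx i 0)).
  apply/funext => v; have h1 := is_derive_ridge x c v (delta_mx i 0)
    (fun i => (dl i).1).
  have h2 := is_derive_sqnorm lambda v (delta_mx i 0).
  rewrite (@derive_val _ _ _ _ _ _ _ (is_deriveD h1 h2)).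
  rewrite -[RHS]/(_ + _); congr (_ + _).
  by apply: eq_bigr => s _; rewrite dotd; ring.
have h1 := is_derive_ridge x (fun s => c s * x s i 0) w (delta_mx j 0)
    (fun i => (dl i).2).
have h2 := is_derive_dotvl lambda (delta_mx i 0) w (delta_mx j 0).
rewrite (@derive_val _ _ _ _ _ _ _ (is_deriveD h1 h2)) addrC summxE.
congr (_ + _); last by rewrite dotd mxE eqxx andbT eq_sym mulr_natr.
apply: eq_bigr => s _; rewrite dotd !mxE big_ord1 !mxE derive1nS derive1n1.
by ring.
Qed.

End Derivatives.

(** * Reduction to the whitened finite model *)

(** The event is a disjoint union of the sets [B f] on which all [m n] bits are prescribed;
    independence gives each of them its product weight. *)
Lemma bernoulli_event_prob (R : realType) (disp : measure_display)
    (T : measurableType disp) (P : probability T R) (m n : nat) (q : R)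
    (b : 'I_m * 'I_n -> {RV P >-> bool})
    (G : pred {ffun 'I_m -> {ffun 'I_n -> bool}}) :
  0 <= q <= 1 -> mutually_independent b ->
  (forall ti, distribution P (b ti) =1 bernoulli_prob q) ->
  (P [set omega | G [ffun t => [ffun i => b (t, i) omega]]]
   = (\sum_(f | G f) iid_weight (iid_weight (bernoulli_weight q)) f)%:E)%E.
Proof.
move=> q01 ib db.
pose full : {set 'I_m * 'I_n} := finset.setTfor _.
pose B (f : {ffun 'I_m -> {ffun 'I_n -> bool}}) : set T :=
  \bigcap_(ti in [set` full]) (b ti @^-1` [set f ti.1 ti.2]).
have mB f : measurable (B f).
  apply: fin_bigcap_measurable => // ti _.
  by rewrite -[X in measurable X]setTI; apply: measurable_funP.
have BE f omega : B f omega <-> [ffun t => [ffun i => b (t, i) omega]] = f.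
  split=> [h|<- [t i] _]; last by rewrite /= !ffunE.
  apply/ffunP => t; apply/ffunP => i; rewrite !ffunE.
  by have := h (t, i); rewrite /= finset.in_setT; apply.
have PB f : P (B f) = (iid_weight (iid_weight (bernoulli_weight q)) f)%:E.
  rewrite /B (ib full (fun ti => [set f ti.1 ti.2])) //.
  rewrite /iid_weight pair_big /= -prodEFin.
  apply: eq_big => [ti|[t i] _ /=]; first by rewrite finset.in_setT.
  have := db (t, i) [set f t i]; rewrite /distribution /pushforward /= => ->.
  rewrite bernoulli_probE // !diracE /bernoulli_weight.
  have memE (x y : bool) : (x \in [set y]%classic) = (x == y).
    by apply/idP/eqP => [/set_mem|->]; last exact/mem_set.
  rewrite !memE.
  by case: (f t i); rewrite /= ?mule1 ?mule0 ?adde0 ?add0e.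
pose s := [seq f <- index_enum _ | G f].
have -> : [set omega | G [ffun t => [ffun i => b (t, i) omega]]]
    = \bigcup_(f in [set` s]) B f.
  apply/seteqP; split => omega /= [].
    move=> Gf; exists [ffun t => [ffun i => b (t, i) omega]].
      by rewrite /= mem_filter Gf mem_index_enum.
    exact/BE.
  by move=> f; rewrite /= mem_filter => /andP[Gf _] /BE ->.
rewrite measure_fin_bigcup //; last first.
  by move=> f f' _ _ [omega [/BE <- /BE <-]].
rewrite -fsbig_seq ?filter_uniq ?index_enum_uniq // /s big_filter.
rewrite -sumEFin; apply: eq_bigr => f _. exact: PB.
Qed.

Lemma invmx_unique (R : realType) (d : nat) (A B : 'M[R]_d) :
  A *m B = 1%:M -> invmx A = B.
Proof.
by move=> AB; have [uA _] := mulmx1_unit AB; rewrite -(mulKmx uA B) AB mulmx1.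
Qed.

Section Whitening.
Variables (R : realType) (d : nat) (N : 'M[R]_d).
Hypothesis uN : N \in unitmx.

Let M := (invmx N)^T.

Let NTM : N^T *m M = 1%:M.
Proof. by rewrite /M -trmx_mul mulVmx // trmx1. Qed.

Let NMT : N *m invmx N = 1%:M. Proof. exact: mulmxV. Qed.

Lemma invmx_congruence A : A \in unitmx ->
  invmx (N *m A *m N^T) = M *m invmx A *m invmx N.
Proof.
move=> uA; apply: invmx_unique.
rewrite !mulmxA -(mulmxA _ N^T) NTM mulmx1 -(mulmxA _ A) mulmxV //.
by rewrite mulmx1 NMT.
Qed.

Lemma mnorm_whiten u : mnorm (N *m N^T) (M *m u) = Num.sqrt (dotv u u).
Proof.
rewrite /mnorm; congr (Num.sqrt _).
rewrite -mulmxA (mulmxA N^T) NTM mul1mx dotv_mulmx mulmxA.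
by rewrite NTM mul1mx.
Qed.

(** Congruence by [N] multiplies every determinant by [\det N ^ 2], which cancels in the ratio, and
    [(N^-1)^T] carries the Euclidean norm to the norm of [N N^T]. *)
Lemma whitened_average_error (m : nat) (A : 'I_m -> 'M[R]_d) (v : 'cV[R]_d)
    (g := invmx N *m v) :
  (forall t, A t \in unitmx) -> \sum_t \det (A t) != 0 ->
  mnorm (N *m N^T)
    ((\sum_t \det (N *m A t *m N^T))^-1 *:
       (\sum_t \det (N *m A t *m N^T) *: (invmx (N *m A t *m N^T) *m v))
     - invmx (N *m N^T) *m v)
  = Num.sqrt ((\sum_t \det (A t)) ^- 2 *
      dotv (\sum_t (\det (A t) *: (invmx (A t) *m g) - \det (A t) *: g))
           (\sum_t (\det (A t) *: (invmx (A t) *m g) - \det (A t) *: g))).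
Proof.
move=> uA D0; set D := \sum_t \det (A t) in D0 *.
set Z := (X in dotv X _).
have dN0 : \det N != 0 by rewrite -unitfE -unitmxE.
have detE t : \det (N *m A t *m N^T) = \det N ^+ 2 * \det (A t).
  by rewrite !det_mulmx det_tr; ring.
have -> : \sum_t \det (N *m A t *m N^T) = \det N ^+ 2 * D.
  by rewrite /D mulr_sumr; apply: eq_bigr => t _.
have -> : \sum_t \det (N *m A t *m N^T) *: (invmx (N *m A t *m N^T) *m v)
    = \det N ^+ 2 *: (M *m (\sum_t \det (A t) *: (invmx (A t) *m g))).
  rewrite mulmx_sumr scaler_sumr; apply: eq_bigr => t _.
  by rewrite detE invmx_congruence // -!mulmxA -scalerA scalemxAr.
have -> : invmx (N *m N^T) *m v = M *m g.
  have := invmx_congruence (unitmx1 R d); rewrite mulmx1 => ->.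
  by rewrite invmx1 mulmx1 -mulmxA.
rewrite scalerA.
have -> : (\det N ^+ 2 * D)^-1 * \det N ^+ 2 = D^-1.
  by field; rewrite D0 dN0.
rewrite scalemxAr -mulmxBr mnorm_whiten.
have -> : D^-1 *: (\sum_t \det (A t) *: (invmx (A t) *m g)) - g = D^-1 *: Z.
  rewrite /Z sumrB scalerBr; congr (_ - _).
  by rewrite -scaler_suml scalerA mulVf // scale1r.
by rewrite dotvZl dotvZr mulrA -expr2 exprVn.
Qed.

End Whitening.

Lemma hessian_loss (R : realType) (n d : nat) (x : 'I_n -> 'cV[R]_d)
    (l : 'I_n -> R -> R) (lambda : R) (w : 'cV[R]_d) :
  (forall i, twice_differentiable (l i)) ->
  hessian (loss x l lambda) w = lambda%:M + \sum_i
    (n%:R^-1 * derive1n 2 (l i) (dotv w (x i))) *: (x i *m (x i)^T).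
Proof.
move=> dl; rewrite -(hessian_ridge x (fun=> n%:R^-1) lambda w dl).
congr (hessian _ w); apply/funext => u; rewrite /loss mulr_sumr.
by [].
Qed.

Lemma hessian_subsampled_loss (R : realType) (n d : nat)
    (x : 'I_n -> 'cV[R]_d) (l : 'I_n -> R -> R) (lambda k : R)
    (b : 'I_n -> bool) (w : 'cV[R]_d) :
  (forall i, twice_differentiable (l i)) ->
  hessian (subsampled_loss x l lambda k b) w = lambda%:M + \sum_i
    (k^-1 * (b i)%:R * derive1n 2 (l i) (dotv w (x i))) *: (x i *m (x i)^T).
Proof.
move=> dl; rewrite -(hessian_ridge x (fun i => k^-1 * (b i)%:R) lambda w dl).
congr (hessian _ w); apply/funext => u; rewrite /subsampled_loss mulr_sumr.
by congr (_ + _); apply: eq_bigr => i _; rewrite mulrA.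
Qed.

Lemma regularized_posdef (R : realType) (n d : nat) (x : 'I_n -> 'cV[R]_d)
    (c : 'I_n -> R) (lambda : R) : 0 < lambda -> (forall i, 0 <= c i) ->
  posdef (lambda%:M + \sum_i c i *: (x i *m (x i)^T)).
Proof.
move=> l0 c0; split.
  rewrite linearD /= tr_scalar_mx raddf_sum /=; congr (_ + _).
  by apply: eq_bigr => i _; rewrite linearZ /= trmx_mul trmxK.
move=> u u0; rewrite mulmxDl mul_scalar_mx dotvDr dotvZr mulmx_suml dotv_sumr.
rewrite ltr_pwDl ?mulr_gt0 ?dotv_gt0 //; apply: sumr_ge0 => i _.
by rewrite -scalemxAl dotvZr dotv_outer (dotvC _ u) -expr2 mulr_ge0 ?sqr_ge0.
Qed.

Lemma ln_ge_half (R : realType) (y : R) : 2 <= y -> 2^-1 <= ln y.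
Proof.
move=> y2; have y0 : 0 < y by apply: lt_le_trans y2.
rewrite -[leLHS]expRK ler_ln ?posrE ?expR_gt0 //; apply: le_trans y2.
have h : 2^-1 <= expR (- 2^-1) :> R by apply: le_trans (expR_ge1Dx _); lra.
by rewrite -[leLHS]invrK -expRN -[leRHS]invrK lef_pV2 ?posrE ?expR_gt0 //
  invr_gt0.
Qed.

Lemma sum_union_le (R : realType) (U : finType) (p : U -> R)
    (G Q1 Q2 : pred U) : (forall u, 0 <= p u) ->
  (forall u, ~~ G u -> Q1 u || Q2 u) ->
  \sum_(u | ~~ G u) p u <= \sum_(u | Q1 u) p u + \sum_(u | Q2 u) p u.
Proof.
move=> p0 h; rewrite !(big_mkcond _ p) /= -big_split /=.
rewrite big_mkcond; apply: ler_sum => u _; have := h u; have := p0 u.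
by case: (G u) (Q1 u) (Q2 u) => [] [] [] //= pu H; rewrite ?addr0 ?add0r //;
  do ?[by rewrite addr_ge0|by rewrite lerDl|by have := H isT].
Qed.
Theorem corollary4 (R : realType) :
  exists2 C : R, 0 < C &
  forall (n d m : nat) (x : 'I_n -> 'cV[R]_d) (l : 'I_n -> R -> R)
    (lambda k : R)
    (disp : measure_display) (T : measurableType disp) (P : probability T R)
    (b : 'I_m * 'I_n -> {RV P >-> bool})
    (w : 'cV[R]_d) (delta eta : R),
  (0 < d)%N -> (0 < m)%N ->
  (forall i, convex_on_line (l i)) ->
  (forall i, twice_differentiable (l i)) ->
  (forall i, smooth (l i)) ->
  0 < lambda ->
  0 < k <= n%:R ->
  mutually_independent b ->
  (forall ti, distribution P (b ti) =1 bernoulli_prob (k / n%:R)) ->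
  0 < delta < 1 -> 0 < eta < 1 ->
  (1 < d)%N \/ delta <= 2^-1 ->
  let L := loss x l lambda in
  let Lhat (t : 'I_m) (omega : T) :=
    subsampled_loss x l lambda k (fun i => b (t, i) omega) in
  let a t omega := \det (hessian (Lhat t omega) w) in
  let phat t omega := invmx (hessian (Lhat t omega) w) *m gradient L w in
  let p := invmx (hessian L w) *m gradient L w in
  let mu := coherence x l lambda w in
  k >= C * eta ^- 2 * mu * d%:R ^+ 2 * ln (d%:R / delta) ^+ 3 ->
  (P [set omega |
       (mnorm (hessian L w)
          ((\sum_(t < m) a t omega)^-1 *:
             (\sum_(t < m) a t omega *: phat t omega) - p)
        <= eta / Num.sqrt m%:R * mnorm (hessian L w) p)%R]
   >= (1 - delta)%:E)%E.
Proof.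
(* 27 comes from [r <= 3 Lg] cubed and [2^16] from [adj_error_tail]; the remaining [2^8] makes the
   ratio [X] at most [1/256]. *)
exists (27 * 2 ^+ 24); first by rewrite mulr_gt0 ?exprn_gt0.
move=> n d m x l lambda k disp T P b w delta eta d0 m0 cl dl _ lambda0 k0n ib db.
move=> /andP[delta0 delta1] /andP[eta0 eta1] d_delta L Lhat a phat p mu.
set C := 27 * _; set Lg := ln _ => hk.
have C0 : 0 < C by rewrite mulr_gt0 ?exprn_gt0.
case/andP: (k0n) => k0 kn.
have n0 : 0 < n%:R :> R by apply: lt_le_trans kn.
have d0' : 0 < d%:R :> R by rewrite ltr0n.
have m0' : 0 < m%:R :> R by rewrite ltr0n.
have dd0 : 0 < d%:R / delta by rewrite divr_gt0.
have d1 : 1 <= d%:R :> R by rewrite ler1n.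
(* [d / delta >= 2] keeps the logarithm away from 0, so that rounding it up to [r] costs at most a
   factor 3. *)
have Lg_half : 2^-1 <= Lg.
  apply: ln_ge_half; rewrite ler_pdivlMr //; case: d_delta => h; last lra.
  have : 2 <= d%:R :> R by rewrite ler_nat.
  nra.
have Lg0 : 0 < Lg by apply: lt_le_trans Lg_half; rewrite invr_gt0.
pose r := (Num.trunc Lg).+1.
have r0 : (0 < r)%N by [].
have /andP[tr1 tr2] := truncn_itv (ltW Lg0).
have Lgr : Lg <= r%:R by apply: ltW.
have r3 : r%:R <= 3 * Lg by rewrite /r -natr1; lra.
have r1 : 1 <= r%:R :> R by rewrite ler1n.
(* Defined from the target accuracy rather than as [mu d / k], so that it stays positive when [mu]
   vanishes; the assumption on [k] then says [d mu <= k eps]. *)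
pose eps := eta ^+ 2 / (C * d%:R * Lg ^+ 3).
have Lg3 : 0 < Lg ^+ 3 by rewrite exprn_gt0.
have eps0 : 0 < eps by rewrite divr_gt0 ?exprn_gt0 // !mulr_gt0.
have edE : eps * d%:R = eta ^+ 2 / (C * Lg ^+ 3).
  by rewrite /eps; field; rewrite !gt_eqF.
pose X := 2 ^+ 16 * (r%:R ^+ 3 * (eps * d%:R)) / eta ^+ 2.
have X256 : X <= 2 ^- 8.
  have -> : X = 2 ^+ 16 * (r%:R ^+ 3 / (C * Lg ^+ 3)).
    by rewrite /X edE; field; rewrite !gt_eqF.
  have : r%:R ^+ 3 <= (3 * Lg) ^+ 3.
    by rewrite lerXn2r ?nnegrE // mulr_ge0 // ltW.
  rewrite exprMn => h.
  apply: (@le_trans _ _ (2 ^+ 16 * (3 ^+ 3 * Lg ^+ 3 / (C * Lg ^+ 3)))).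
    by rewrite ler_wpM2l ?exprn_ge0 // ler_wpM2r // invr_ge0 ltW // mulr_gt0.
  rewrite le_eqVlt; apply/orP; left; apply/eqP; rewrite /C; field.
  by rewrite gt_eqF.
have eX : r%:R ^+ 3 * (eps * d%:R) <= 2 ^- 16 * X.
  have -> : 2 ^- 16 * X = (r%:R ^+ 3 * (eps * d%:R)) / eta ^+ 2.
    by rewrite /X; field; rewrite gt_eqF.
  rewrite ler_pdivlMr ?exprn_gt0 // ler_piMr ?exprn_ile1 ?(ltW eta0) ?(ltW eta1) //.
  by rewrite mulr_ge0 ?exprn_ge0 // mulr_ge0 ?(ltW eps0).
have ed0 : 0 < eps * d%:R by rewrite mulr_gt0.
have small : 32 * (r%:R ^+ 2 * (eps * d%:R)) <= 1.
  have : r%:R ^+ 2 * (eps * d%:R) <= r%:R ^+ 3 * (eps * d%:R).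
    by rewrite ler_wpM2r ?(ltW ed0) // [leRHS]exprS ler_peMl // exprn_ge0.
  lra.
pose c i := derive1n 2 (l i) (dotv w (x i)).
have c0 i : 0 <= c i by apply: convex_derive2_ge0.
have HE := hessian_loss x lambda w dl.
have pH : posdef (hessian L w).
  rewrite HE; apply: regularized_posdef => // i.
  by rewrite mulr_ge0 // ?invr_ge0 ?c0 // ltW.
have [N [tN dN NN]] := cholesky pH.
have uN : N \in unitmx.
  by have := posdef_unit pH; rewrite -NN unitmx_mul => /andP[].
pose K := invmx N.
have KN : K *m N = 1%:M by apply: mulVmx.
have NK : N *m K = 1%:M by apply: mulmxV.
have NTKT : N^T *m K^T = 1%:M by rewrite -trmx_mul KN trmx1.
have KTNT : K^T *m N^T = 1%:M by rewrite -trmx_mul NK trmx1.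
(* The squared length of [v i] is the term of index [i] in the maximum defining [mu]. *)
pose v i := Num.sqrt (c i) *: (K *m x i).
pose B0 := lambda *: (K *m K^T).
have vv i : v i *m (v i)^T = c i *: (K *m (x i *m (x i)^T) *m K^T).
  rewrite /v -scalemxAl linearZ /= -scalemxAr scalerA -expr2 sqr_sqrtr //.
  by rewrite trmx_mul !mulmxA.
have pB0 : posdef B0.
  split; first by rewrite linearZ /= trmx_mul trmxK.
  move=> u u0; rewrite -scalemxAl dotvZr mulr_gt0 // -mulmxA dotv_mulmx.
  rewrite dotv_gt0; apply: contra_neq u0 => h.
  by rewrite -[u]mul1mx -NTKT -mulmxA h mulmx0.
have isotropic : B0 + n%:R^-1 *: \sum_i (v i *m (v i)^T) = 1%:M.
  have <- : K *m hessian L w *m K^T = 1%:M.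
    by rewrite -NN mulmxA KN mul1mx NTKT.
  rewrite HE mulmxDr mulmxDl mul_mx_scalar -scalemxAl mulmx_sumr mulmx_suml.
  rewrite scaler_sumr; congr (_ + _); apply: eq_bigr => i _.
  by rewrite vv scalerA -scalemxAr -scalemxAl.
have v_le i : dotv (v i) (v i) <= k * eps.
  have iH : invmx (hessian L w) = K^T *m K.
    apply: invmx_unique; rewrite -NN -!mulmxA (mulmxA N^T) NTKT mul1mx.
    exact: NK.
  have -> : dotv (v i) (v i) = c i * mnorm (invmx (hessian L w)) (x i) ^+ 2.
    rewrite /mnorm iH -mulmxA dotv_mulmx trmxK sqr_sqrtr ?dotv_ge0 //.
    by rewrite /v dotvZl dotvZr mulrA -expr2 sqr_sqrtr.
  apply: (@le_trans _ _ (d%:R * mu)).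
    rewrite /mu /coherence [leRHS]mulrA divff ?gt_eqF // mul1r.
    exact: (le_bigmax 0 (fun i => derive1n 2 (l i) (dotv w (x i)) *
      mnorm (invmx (hessian (loss x l lambda) w)) (x i) ^+ 2) i).
  rewrite /eps mulrA ler_pdivlMr ?mulr_gt0 //.
  rewrite mulrC -ler_pdivrMr ?exprn_gt0 //; apply: le_trans hk.
  by rewrite le_eqVlt; apply/orP; left; apply/eqP; field; rewrite gt_eqF.
pose g := K *m gradient L w.
pose A (f : {ffun 'I_n -> bool}) := sketch B0 v k f.
have pA f : posdef (A f) by apply: sketch_posdef.
have hatE t omega : hessian (Lhat t omega) w
    = N *m A [ffun i => b (t, i) omega] *m N^T.
  rewrite hessian_subsampled_loss // /A /sketch mulmxDr mulmxDl; congr (_ + _).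
    rewrite /B0 -scalemxAr -scalemxAl mulmxA NK mul1mx KTNT.
    by rewrite scalemx1.
  rewrite scaler_sumr mulmx_sumr mulmx_suml; apply: eq_bigr => i _.
  rewrite ffunE vv !scalerA -scalemxAr -scalemxAl; congr (_ *: _).
    by rewrite mulrA.
  by rewrite !mulmxA NK mul1mx -!mulmxA KTNT mulmx1.
pose Z (ff : {ffun 'I_m -> {ffun 'I_n -> bool}}) :=
  \sum_t adj_error B0 v k g (ff t).
pose D (ff : {ffun 'I_m -> {ffun 'I_n -> bool}}) := \sum_t \det (A (ff t)).
pose G (ff : {ffun 'I_m -> {ffun 'I_n -> bool}}) :=
  Num.sqrt ((D ff) ^- 2 * dotv (Z ff) (Z ff))
  <= eta / Num.sqrt m%:R * Num.sqrt (dotv g g).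
have D0 ff : 0 < D ff.
  rewrite /D (bigD1 (Ordinal m0)) //= ltr_pwDl ?posdef_det_gt0 //.
  by apply: sumr_ge0 => t _; apply: ltW; apply: posdef_det_gt0.
have pE : mnorm (hessian L w) p = Num.sqrt (dotv g g).
  rewrite /p -NN; have := invmx_congruence uN (unitmx1 R d).
  by rewrite mulmx1 invmx1 mulmx1 => ->; rewrite -mulmxA mnorm_whiten.
have errE omega : mnorm (hessian L w) ((\sum_(t < m) a t omega)^-1 *:
      (\sum_(t < m) a t omega *: phat t omega) - p)
    = Num.sqrt (D [ffun t => [ffun i => b (t, i) omega]] ^- 2 *
        dotv (Z [ffun t => [ffun i => b (t, i) omega]])
             (Z [ffun t => [ffun i => b (t, i) omega]])).
  set ff := [ffun t => [ffun i => b (t, i) omega]].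
  have AE t : hessian (Lhat t omega) w = N *m A (ff t) *m N^T.
    by rewrite hatE /ff ffunE.
  have -> : \sum_(t < m) a t omega = \sum_t \det (N *m A (ff t) *m N^T).
    by apply: eq_bigr => t _; rewrite /a AE.
  have -> : \sum_(t < m) a t omega *: phat t omega
      = \sum_t \det (N *m A (ff t) *m N^T) *:
          (invmx (N *m A (ff t) *m N^T) *m gradient L w).
    by apply: eq_bigr => t _; rewrite /a /phat AE.
  have uA t : A (ff t) \in unitmx by apply: posdef_unit.
  have Dff0 : \sum_t \det (A (ff t)) != 0 by apply: lt0r_neq0 (D0 ff).
  by rewrite /p -NN whitened_average_error.
have -> : [set omega | (mnorm (hessian L w)
          ((\sum_(t < m) a t omega)^-1 *:
             (\sum_(t < m) a t omega *: phat t omega) - p)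
        <= eta / Num.sqrt m%:R * mnorm (hessian L w) p)%R]
   = [set omega | G [ffun t => [ffun i => b (t, i) omega]]].
  by apply/funext => omega /=; rewrite pE errE.
have q01 : 0 <= k / n%:R <= 1.
  by rewrite divr_ge0 ?(ltW k0) ?(ltW n0) // ler_pdivrMr // mul1r.
rewrite (bernoulli_event_prob G q01 ib db) lee_fin.
pose W := iid_weight (I := 'I_m)
  (iid_weight (I := 'I_n) (bernoulli_weight (k / n%:R))).
have wW : weights W by do 2!apply: weights_iid; apply: weights_bernoulli.
have := wW.2; rewrite (bigID G) /= -/W.
suff : \sum_(f | ~~ G f) W f <= delta by move=> h1 h2; lra.
(* Outside [Q1] and [Q2], [|Z| <= (eta / 2) sqrt m |g|] and [D >= m / 2]; the two halves cancel in
   the ratio. *)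
pose Q1 ff := (eta / 2) ^+ 2 * (m%:R * dotv g g) < dotv (Z ff) (Z ff).
pose Q2 ff := D ff < m%:R / 2.
apply: le_trans (sum_union_le (Q1 := Q1) (Q2 := Q2) wW.1 _) _.
  move=> ff; apply: contraR; rewrite negb_or -!leNgt => /andP[h1 h2].
  have gg := dotv_ge0 g.
  rewrite /G -[leRHS]ger0_norm ?mulr_ge0 ?invr_ge0 ?sqrtr_ge0 ?(ltW eta0) //.
  rewrite -sqrtr_sqr ler_wsqrtr // exprMn expr_div_n !sqr_sqrtr ?ler0n //.
  rewrite mulrC ler_pdivrMr ?exprn_gt0 //; apply: le_trans h1 _.
  have -> : (eta / 2) ^+ 2 * (m%:R * dotv g g)
    = eta ^+ 2 / m%:R * dotv g g * (m%:R / 2) ^+ 2.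
    by field; rewrite gt_eqF.
  rewrite ler_wpM2l ?lerXn2r ?nnegrE ?divr_ge0 ?(ltW (D0 ff)) //.
  by rewrite mulr_ge0 // divr_ge0 ?sqr_ge0.
have X0 : 0 <= X.
  by rewrite /X -mulrA mulr_ge0 ?exprn_ge0 // divr_ge0 ?sqr_ge0 // mulr_ge0
    ?exprn_ge0 // ltW.
have b2 : \sum_(f | Q2 f) W f <= X ^+ r.
  apply: le_trans (det_sum_tail d0 pB0 k0n isotropic eps0 v_le r0 small m0) _.
  rewrite lerXn2r ?nnegrE //.
    by rewrite mulr_ge0 ?exprn_ge0 // mulr_ge0 // ltW.
  have : r%:R * (eps * d%:R) <= r%:R ^+ 3 * (eps * d%:R).
    rewrite ler_wpM2r ?(ltW ed0) // [leRHS]exprS ler_peMr //.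
    by rewrite exprn_ege1.
  move: eX; lra.
have b1 : \sum_(f | Q1 f) W f <= 16 * X ^+ r.
  (* For [g = 0] the tail lemma does not apply, but [Q1] reads [0 < 0] and is empty. *)
  have [g0|g0] := eqVneq g 0.
    rewrite big_pred0 ?mulr_ge0 ?exprn_ge0 // => ff.
    rewrite /Q1 /Z big1 => [|t _].
      by rewrite g0 /dotv !mulmx0 mxE !mulr0 ltxx.
    by rewrite /adj_error g0 mulmx0 !scaler0 subrr.
  exact: (adj_error_tail d0 pB0 k0n isotropic eps0 v_le r0 small m0 g0 eta0).
apply: le_trans (lerD b1 b2) _.
(* Of the ratio [1/256], the factor [4^-r] is at most [delta / d], and a single 64 absorbs the
   prefactor [16 + 1] of the two tails. *)
have hX : X ^+ r <= 4^-1 ^+ r * 64^-1.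
  apply: (@le_trans _ _ ((4^-1 * 64^-1) ^+ r)).
    have <- : 2 ^- 8 = 4^-1 * 64^-1 :> R by field.
    by rewrite lerXn2r ?nnegrE // invr_ge0 exprn_ge0.
  rewrite exprMn ler_wpM2l ?exprn_ge0 ?invr_ge0 //.
  by rewrite -[leRHS]expr1 ler_wiXn2l ?invr_ge0 // invf_le1 // ler1n.
have h4 : 4^-1 ^+ r <= delta.
  have h := expR_nat_le R r.
  rewrite exprVn; apply: (@le_trans _ _ (expR Lg)^-1).
    rewrite lef_pV2 ?posrE ?expR_gt0 ?exprn_gt0 //.
    by apply: le_trans h; rewrite ler_expR.
  rewrite /Lg lnK ?posrE // invf_div ler_pdivrMr //.
  by rewrite ler_peMr // ltW.
have z0 : 0 <= 4^-1 ^+ r :> R by rewrite exprn_ge0 // invr_ge0.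
have combine (y z : R) : 0 <= z -> y <= z * 64^-1 -> 16 * y + y <= z.
  by clear; lra.
exact: le_trans (combine _ _ z0 hX) h4.
Qed.
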